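(* Let $d\ge 1$ and define the double layer heat kernel $$D(x,y;t)=\frac{(x-y)\cdot n_y}{(4\pi t)^{d/2}\,2t}\,e^{-|x-y|^2/(4t)},\qquad x,y\in\mathbb{R}^d,\ t>0,$$ where $n_y\in\mathbb{R}^d$ is a unit vector (the unit normal at $y$). There is a constant $C_d>0$ such that for every $0<\epsilon<0.1$, every $R>1$ and every $T\ge 1000\delta>0$ there exist positive integers $$N_1\le C_d\log\frac{T}{\delta}\left(\log\frac1\epsilon+\log\log\frac{T}{\delta}+\log R\right),\qquad N_2\le C_d\left(\log\frac1\epsilon+\log R\right)\left(\log\frac{T}{\delta}+\log\frac1\epsilon+\log R\right),$$ positive reals $\tilde w_j,\lambda_j$ ($j=1,\dots,N_2$), and complex numbers $w_k$ and $s_k\in\mathbb{C}\setminus(-\infty,0]$ ($k=-N_1,\dots,N_1$) such that $$D_A(x,y;t)=\sum_{j=1}^{N_2}\tilde w_j e^{-\lambda_j t}\sum_{k=-N_1}^{N_1}w_k e^{s_k t}e^{-\sqrt{s_k}|x-y|}\,(x-y)\cdot n_y$$ satisfies $|D(x,y;t)-D_A(x,y;t)|<\frac{\epsilon}{t^{(d+2)/2}}$ for all $x,y\in\mathbb{R}^d$ with $|x-y|\le R$, all unit vectors $n_y$, and all $t\in[\delta,T]$.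
   Context: $|\cdot|$ is the Euclidean norm and $\cdot$ the Euclidean inner product on $\mathbb{R}^d$; $\sqrt{s}$ denotes the principal branch of the square root on $\mathbb{C}\setminus(-\infty,0]$. *)

(* Defs.v *)
From Stdlib Require Import Reals Lra ZArith.
Open Scope R_scope.

(* ---------- vectors in R^d, represented as nat -> R (only coords 0..d-1 matter) ---------- *)
Fixpoint dotn (d : nat) (u v : nat -> R) : R :=
  match d with
  | O => 0
  | S k => dotn k u v + u k * v k
  end.

Definition vsub (u v : nat -> R) : nat -> R := fun i => u i - v i.

Definition vnorm (d : nat) (u : nat -> R) : R := sqrt (dotn d u u).

Definition unit_vec (d : nat) (n : nat -> R) : Prop := vnorm d n = 1.

Definition Cx := (R * R)%type.
Definition RtoC (a : R) : Cx := (a, 0).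
Definition Cadd (z w : Cx) : Cx := (fst z + fst w, snd z + snd w).
Definition Csub (z w : Cx) : Cx := (fst z - fst w, snd z - snd w).
Definition Cmul (z w : Cx) : Cx :=
  (fst z * fst w - snd z * snd w, fst z * snd w + snd z * fst w).
Definition Cmod (z : Cx) : R := sqrt (fst z ^ 2 + snd z ^ 2).
Definition Cexp (z : Cx) : Cx := (exp (fst z) * cos (snd z), exp (fst z) * sin (snd z)).

Definition on_neg_real_axis (z : Cx) : Prop := snd z = 0 /\ fst z <= 0.

(* principal square root (valid off (-infinity,0]) *)
Definition Csqrt (z : Cx) : Cx :=
  let a := fst z in let b := snd z in
  let m := Cmod z in
  (sqrt ((m + a) / 2),
   (if Rlt_dec b 0 then -1 else 1) * sqrt ((m - a) / 2)).

Fixpoint Csum (n : nat) (f : nat -> Cx) : Cx :=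
  match n with
  | O => RtoC 0
  | S k => Cadd (Csum k f) (f k)
  end.

Definition Dker (d : nat) (x y ny : nat -> R) (t : R) : R :=
  dotn d (vsub x y) ny / (Rpower (4 * PI * t) (INR d / 2) * (2 * t))
  * exp (- (vnorm d (vsub x y)) ^ 2 / (4 * t)).

Definition DAker (d : nat) (N1 N2 : nat) (wt lam : nat -> R) (w s : Z -> Cx)
    (x y ny : nat -> R) (t : R) : Cx :=
  let r := vnorm d (vsub x y) in
  let inner :=
    Csum (2 * N1 + 1) (fun i =>
      let k := (Z.of_nat i - Z.of_nat N1)%Z in
      Cmul (w k) (Cmul (Cexp (Cmul (s k) (RtoC t)))
                       (Cexp (Cmul (RtoC (- r)) (Csqrt (s k)))))) in
  Csum N2 (fun i =>
      let j := S i in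
      Cmul (RtoC (wt j * exp (- lam j * t) * dotn d (vsub x y) ny)) inner).

(* Main.v *)
From Coquelicot Require Import Coquelicot.
Require Import Defs.
From Stdlib Require Import Reals ZArith Lra Lia Psatz List Classical.
Open Scope R_scope.

(** With r = |x-y| the kernel is, up to a constant and the factor (x-y).n, the product of
    t^{-(d+1)/2} and t^{-1/2} e^{-r^2/4t}.  The first factor is a multiple of the integral of
    y^d e^{-y^2 t} over y > 0.  The second one is a multiple of the integral of e^{z^2 t - z r} along
    the rays z = x +- 2i (x - c), x >= c, on which Re z > 0 and Re z^2 is negative away from the
    corner; the choice c^2 T ~ log (1/eta) lets the truncation point X satisfy X / c ~ (T/delta)^{1/2},
    uniformly in r.  Both integrals are cut into geometric panels, on which the integrands
    are approximated by Taylor polynomials of degree O(log (1/eta)).  On each panel a fine Riemann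
    sum is reduced by Caratheodory's argument to as many positive nodes as there are moments to
    preserve.  The nodes are lambda = y^2 and s = z^2.  The normalising constants are truncated
    integrals, of which only lower bounds are needed. *)

(** * Positive quadrature by Caratheodory reduction *)

(** The obstacle is uniformity: nodes and weights may depend on eps, R, T and delta, but not on t or
    r. A rule is therefore built for a whole class of integrands, those sharing a Lipschitz constant
    and a quality of polynomial approximation. The Lipschitz constant may be huge, since it only
    fixes how fine the Riemann sum is before reduction; the number of nodes that survive is the
    degree. Positive weights serve twice: the theorem asks for them in the first factor, and they
    bound the weights by the length of the panel, so that approximation errors are not amplified.

    On the rays the uniformity in r comes from z^2 t - z r = (tau z - r/(2 tau))^2 - r^2/(4t) with
    tau = sqrt t. The Gaussian factors out exactly, and the corner z = c goes to a real point, where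
    the imaginary part of the primitive of e^{w^2} vanishes.

    The two bounds differ because the first factor loses only algebraically at both cuts, so its
    range has ratio about (1/eta)^2 (T/delta)^{1/2}, while the contour loses exponentially and needs
    only (T/delta)^{1/2}. Each logarithm of a range counts panels; the degree on a panel is O(log
    (1/eta)). *)

Fixpoint qsum (g : R -> R) (l : list (R * R)) : R :=
  match l with
  | nil => 0
  | p :: l' => fst p * g (snd p) + qsum g l'
  end.

Lemma qsum_app g l1 l2 : qsum g (l1 ++ l2) = qsum g l1 + qsum g l2.
Proof. induction l1 as [|p l IH]; simpl; [lra | rewrite IH; lra]. Qed.

Lemma qsum_ext g h l : (forall p, In p l -> g (snd p) = h (snd p)) -> qsum g l = qsum h l.
Proof.
induction l as [|p l IH]; simpl; intros H; [reflexivity|].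
rewrite (H p (or_introl eq_refl)), IH; auto.
Qed.

Lemma qsum_lin a g b h l :
  qsum (fun x => a * g x + b * h x) l = a * qsum g l + b * qsum h l.
Proof. induction l as [|p l IH]; simpl; [lra | rewrite IH; lra]. Qed.

(* Degree less than [m], in Horner form. *)
Fixpoint polyn (m : nat) (g : R -> R) : Prop :=
  match m with
  | O => forall x, g x = 0
  | S k => exists c h, polyn k h /\ forall x, g x = c + x * h x
  end.

Lemma polyn_ext m g h : (forall x, g x = h x) -> polyn m g -> polyn m h.
Proof.
destruct m; simpl; intros E H; [intro; rewrite <- E; apply H|].
destruct H as (c & k & Hk & H); exists c, k; split; [exact Hk|].
intro; rewrite <- E; apply H.
Qed.

Lemma polyn_zero m : polyn m (fun _ => 0).
Proof.
induction m; simpl; [reflexivity|].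
exists 0, (fun _ => 0); split; [exact IHm | intro; ring].
Qed.

Lemma polyn_S m g : polyn m g -> polyn (S m) g.
Proof.
revert g; induction m as [|m IH]; intros g H.
- exists 0, (fun _ => 0); split; [apply polyn_zero | intro x; rewrite H; ring].
- destruct H as (c & h & Hh & H); exists c, h; split; [apply IH, Hh | exact H].
Qed.

Lemma polyn_le m n g : (m <= n)%nat -> polyn m g -> polyn n g.
Proof. induction 1; auto using polyn_S. Qed.

Lemma polyn_lin m a g b h :
  polyn m g -> polyn m h -> polyn m (fun x => a * g x + b * h x).
Proof.
revert g h; induction m as [|m IH]; simpl; intros g h Hg Hh.
- intro x; rewrite Hg, Hh; ring.
- destruct Hg as (c1 & g1 & Hg1 & Hg), Hh as (c2 & h1 & Hh1 & Hh).
  exists (a * c1 + b * c2), (fun x => a * g1 x + b * h1 x); split; [auto|].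
  intro x; rewrite Hg, Hh; ring.
Qed.

Lemma polyn_const c : polyn 1 (fun _ => c).
Proof. exists c, (fun _ => 0); split; [intro; reflexivity | intro; ring]. Qed.

Lemma polyn_mulX m g : polyn m g -> polyn (S m) (fun x => x * g x).
Proof. intro H; exists 0, g; split; [exact H | intro; ring]. Qed.

Lemma polyn_mul m n g h : polyn m g -> polyn n h -> polyn (m + n) (fun x => g x * h x).
Proof.
revert g; induction m as [|m IH]; simpl; intros g Hg Hh.
- apply polyn_ext with (fun _ => 0); [intro; rewrite Hg; ring | apply polyn_zero].
- destruct Hg as (c & k & Hk & Hg).
  apply (polyn_ext (S (m + n)) (fun x => c * h x + 1 * (x * (k x * h x)))).
  { intro x; rewrite Hg; ring. }
  apply polyn_lin; [apply polyn_le with n; [lia | exact Hh]|].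
  apply (polyn_mulX (m + n)), IH; assumption.
Qed.

Lemma polyn_pow d : polyn (S d) (fun x => x ^ d).
Proof.
induction d as [|d IH].
- apply polyn_ext with (fun _ => 1); [intro; simpl; ring | apply polyn_const].
- apply (polyn_mulX (S d) (fun x => x ^ d)), IH.
Qed.

Lemma qsum_polyn m g l1 l2 : polyn m g ->
  (forall k, (k < m)%nat -> qsum (fun x => x ^ k) l1 = qsum (fun x => x ^ k) l2) ->
  qsum g l1 = qsum g l2.
Proof.
intros Hg HM.
(* Each Horner step pulls out a factor x, so the induction carries x^j and uses up the j-th moment
   at each stage. *)
assert (G : forall m g j, polyn m g ->
  (forall k, (k < m)%nat -> qsum (fun x => x ^ (j + k)) l1 = qsum (fun x => x ^ (j + k)) l2) ->
  qsum (fun x => x ^ j * g x) l1 = qsum (fun x => x ^ j * g x) l2).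
{ clear. induction m as [|m IH]; intros g j Hg HM.
  - assert (E : forall l, qsum (fun x => x ^ j * g x) l = qsum (fun _ => 0) l).
    { intro l; apply qsum_ext; intros p _; rewrite Hg; ring. }
    rewrite !E.
    assert (Z : forall l, qsum (fun _ => 0) l = 0).
    { induction l; simpl; [reflexivity | rewrite IHl; ring]. }
    now rewrite !Z.
  - destruct Hg as (c & h & Hh & Hg).
    assert (E : forall l, qsum (fun x => x ^ j * g x) l
       = c * qsum (fun x => x ^ j) l + 1 * qsum (fun x => x ^ (S j) * h x) l).
    { intro l; rewrite <- qsum_lin; apply qsum_ext; intros p _; rewrite Hg; simpl; ring. }
    rewrite !E, (IH h (S j)); [|exact Hh|].
    + specialize (HM 0%nat ltac:(lia)); rewrite Nat.add_0_r in HM; now rewrite HM.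
    + intros k Hk; specialize (HM (S k) ltac:(lia)); rewrite Nat.add_succ_r in HM; exact HM. }
assert (E : forall l, qsum g l = qsum (fun x => x ^ 0 * g x) l).
{ intro l; apply qsum_ext; intros; simpl; ring. }
rewrite !E; apply (G m); assumption.
Qed.

(* The vectors are functions on [nat], of which only the first coordinates matter. *)
Fixpoint lcomb (k : nat) (l : list (R * (nat -> R))) : R :=
  match l with
  | nil => 0
  | p :: l' => fst p * snd p k + lcomb k l'
  end.

Lemma lcomb_app k l1 l2 : lcomb k (l1 ++ l2) = lcomb k l1 + lcomb k l2.
Proof. induction l1; simpl; [lra | rewrite IHl1; lra]. Qed.

(** Gaussian elimination on the last coordinate. If some [v] in the list has v m <> 0, subtracting
    multiples of it clears that coordinate from the others, and a dependency among the reduced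
    vectors lifts back; otherwise the coordinate can be ignored. *)
Lemma lin_dep m : forall l : list (nat -> R), (m < length l)%nat ->
  exists l', map snd l' = l /\ (exists p, In p l' /\ fst p <> 0) /\
    forall k, (k < m)%nat -> lcomb k l' = 0.
Proof.
induction m as [|m IH]; intros l Hl.
- exists (map (fun v => (1, v)) l); split; [|split].
  + rewrite map_map; apply map_id.
  + destruct l as [|v l]; simpl in Hl; [lia|].
    exists (1, v); split; [now left | simpl; lra].
  + intros; lia.
- destruct (classic (exists v, In v l /\ v m <> 0)) as [(v & Hv & Hm)|H0].
  + destruct (in_split _ _ Hv) as (l1 & l2 & ->).
    rewrite length_app in Hl; simpl in Hl.
    pose (red := fun (u : nat -> R) k => u k - u m / v m * v k).
    destruct (IH (map red (l1 ++ l2))) as (l' & E & (p & Hp & Hp0) & H).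
    { rewrite length_map, length_app; lia. }
    (* The coefficients stay the same when reduced vectors are replaced by the original ones; the
       combination changes by a multiple of [v], which the coefficient given to [v] below
       cancels. *)
    assert (lift : forall a l', map snd l' = map red a -> exists b, map snd b = a /\
        (map fst b = map fst l') /\
        forall k, lcomb k b = lcomb k l' + lcomb m b / v m * v k).
    { clear - Hm; induction a as [|u a IHa]; intros l' E.
      - destruct l'; [|discriminate]; exists nil; repeat split; intros; simpl; field; exact Hm.
      - destruct l' as [|p l']; [discriminate|]; simpl in E; injection E as E1 E2.
        destruct (IHa l' E2) as (b & B1 & B2 & B3).
        exists ((fst p, u) :: b); simpl; rewrite B1, B2; repeat split.
        intro k; rewrite (B3 k), E1; unfold red; field; exact Hm. }
    destruct (lift (l1 ++ l2) l' E) as (b & B1 & B2 & B3).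
    destruct (map_eq_app _ _ _ _ B1) as (b1 & b2 & -> & B4 & B5).
    exists (b1 ++ (- (lcomb m (b1 ++ b2) / v m), v) :: b2); split; [|split].
    * now rewrite map_app; simpl; rewrite B4, B5.
    * assert (Hin : In (fst p) (map fst (b1 ++ b2))) by (rewrite B2; now apply in_map).
      apply in_map_iff in Hin; destruct Hin as (x & Ex & Hx).
      exists x; split; [|now rewrite Ex].
      apply in_app_or in Hx; apply in_or_app; simpl; tauto.
    * intros k Hk; rewrite lcomb_app; simpl.
      assert (S : lcomb k b1 + lcomb k b2 = lcomb k (b1 ++ b2)) by now rewrite lcomb_app.
      destruct (Nat.eq_dec k m) as [->|Hkm].
      -- replace (lcomb m b1 + (- (lcomb m (b1 ++ b2) / v m) * v m + lcomb m b2))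
           with ((lcomb m b1 + lcomb m b2) - lcomb m (b1 ++ b2)) by (field; exact Hm).
         rewrite S; ring.
      -- assert (Hk' := B3 k); rewrite (H k) in Hk' by lia; lra.
  + destruct (IH l) as (l' & E & N & H); [lia|].
    exists l'; split; [exact E|]; split; [exact N|].
    intros k Hk; destruct (Nat.eq_dec k m) as [->|Hkm]; [|apply H; lia].
    assert (Z : forall p, In p l' -> snd p m = 0).
    { intros p Hp; apply NNPP; intro Hn; apply H0; exists (snd p); split; [|exact Hn].
      rewrite <- E; now apply in_map. }
    clear - Z; induction l' as [|p l' IHl]; simpl; [reflexivity|].
    rewrite (Z p), IHl; [ring| |now left].
    intros; apply Z; now right.
Qed.

(** The ratio test of the simplex method: [th] is the least quotient of weight by coefficient among
    the entries with positive coefficient. It is nonnegative, so entries with nonpositive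
    coefficient do not decrease. *)
Lemma vanishing_step (l : list ((R * R) * R)) :
  (forall p, In p l -> 0 < fst (fst p)) -> (exists p, In p l /\ 0 < snd p) ->
  exists th, (forall p, In p l -> 0 <= fst (fst p) - th * snd p) /\
    exists p, In p l /\ fst (fst p) - th * snd p = 0.
Proof.
intros Hpos Hex.
assert (G : exists th, 0 <= th /\ (forall p, In p l -> 0 < snd p -> 0 <= fst (fst p) - th * snd p) /\
    exists p, In p l /\ fst (fst p) - th * snd p = 0).
{ induction l as [|p l IH]; [destruct Hex as (? & [] & _)|].
  assert (Hp := Hpos p (or_introl eq_refl)).
  destruct (classic (exists p0, In p0 l /\ 0 < snd p0)) as [He|He].
  - destruct IH as (th & T0 & T1 & q & Hq & T2); [intros; apply Hpos; now right | exact He|].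
    destruct (Rle_lt_dec (snd p) 0) as [Hs|Hs].
    { exists th; split; [exact T0|]; split; [|exists q; split; [now right|exact T2]].
      intros p0 [<-|Hin] H; [lra | auto]. }
    destruct (Rle_lt_dec 0 (fst (fst p) - th * snd p)) as [Ht|Ht].
    + exists th; split; [exact T0|]; split; [|exists q; split; [now right|exact T2]].
      intros p0 [<-|Hin] H; auto.
    + exists (fst (fst p) / snd p); split; [apply Rlt_le, Rdiv_lt_0_compat; assumption|].
      assert (L : fst (fst p) / snd p <= th).
      { apply Rmult_le_reg_r with (snd p); [exact Hs|].
        unfold Rdiv; rewrite Rmult_assoc, Rinv_l by lra; lra. }
      split.
      * intros p0 [<-|Hin] H; [right; field; lra|].
        assert (H1 := T1 p0 Hin H).
        assert (fst (fst p) / snd p * snd p0 <= th * snd p0) by (apply Rmult_le_compat_r; lra).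
        lra.
      * exists p; split; [now left | field; lra].
  - destruct Hex as (q & [<-|Hq] & Hs); [|exfalso; apply He; exists q; tauto].
    exists (fst (fst p) / snd p); split; [apply Rlt_le, Rdiv_lt_0_compat; assumption|].
    split; [|exists p; split; [now left | field; lra]].
    intros p0 [<-|Hin] H; [right; field; lra | exfalso; apply He; exists p0; tauto]. }
destruct G as (th & T0 & T1 & T2); exists th; split; [|exact T2].
intros p Hp; destruct (Rle_lt_dec (snd p) 0) as [Hs|Hs]; [|auto].
assert (H := Hpos p Hp).
assert (0 <= th * - snd p) by (apply Rmult_le_pos; lra); lra.
Qed.

(* Caratheodory's reduction: a positive rule with more than [m] nodes can be moved along
   a null combination of its first [m] moments until one of its weights vanishes. *)
Lemma caratheodory m : forall l : list (R * R), (forall p, In p l -> 0 < fst p) ->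
  exists l', (length l' <= m)%nat /\
    (forall p, In p l' -> 0 < fst p /\ exists q, In q l /\ snd q = snd p) /\
    forall k, (k < m)%nat -> qsum (fun x => x ^ k) l' = qsum (fun x => x ^ k) l.
Proof.
intros l; remember (length l) as n eqn:Hn; assert (Hn' : (length l <= n)%nat) by lia.
clear Hn; revert l Hn'; induction n as [|n IH]; intros l Hn Hpos.
{ exists l; destruct l; simpl in *; [|lia]; repeat split; simpl; intros; try tauto; lia. }
destruct (Nat.le_gt_cases (length l) m) as [Hlm|Hlm].
{ exists l; repeat split; auto; exists p; auto. }
destruct (lin_dep m (map (fun p k => snd p ^ k) l)) as (c & E & (q & Hq & Hq0) & Hc).
{ now rewrite length_map. }
(* The ratio test needs a positive coefficient, while the dependency only has a nonzero one;
   multiplying it by that coefficient makes its square appear. *)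
assert (G : exists c : list ((R * R) * R), map fst c = l /\ (exists q, In q c /\ 0 < snd q) /\
   forall k, (k < m)%nat ->
     fold_right (fun p s => snd p * snd (fst p) ^ k + s) 0 c = 0).
{ assert (G : forall sg, exists c', map fst c' = l /\ map snd c' = map (fun p => sg * fst p) c /\
     forall k, fold_right (fun p s => snd p * snd (fst p) ^ k + s) 0 c' = sg * lcomb k c).
  { intro sg; clear - E; revert c E; induction l as [|p l IHl]; intros c E.
    - destruct c; [|discriminate]; exists nil; repeat split; intros; simpl; ring.
    - destruct c as [|q c]; [discriminate|]; simpl in E; injection E as E1 E2.
      destruct (IHl c E2) as (c' & C1 & C2 & C3).
      exists ((p, sg * fst q) :: c'); simpl; rewrite C1, C2; repeat split.
      intro k; rewrite C3, E1; ring. }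
  assert (exists sg, 0 < sg * fst q) as (sg & Hsg).
  { exists (fst q); nra. }
  destruct (G sg) as (c' & C1 & C2 & C3); exists c'; split; [exact C1|]; split.
  - assert (Hin : In (sg * fst q) (map snd c')).
    { rewrite C2; apply (in_map (fun p => sg * fst p)), Hq. }
    apply in_map_iff in Hin; destruct Hin as (q' & Q1 & Q2); exists q'; split; [exact Q2|]; now rewrite Q1.
  - intros k Hk; rewrite C3, Hc by exact Hk; ring. }
clear c E q Hq Hq0 Hc; destruct G as (c & E & Hex & Hc).
destruct (vanishing_step c) as (th & T1 & q & Hq & T2).
{ intros p Hp; apply Hpos; rewrite <- E; now apply in_map. }
{ exact Hex. }
(* Taking out the vanished node by hand makes the list strictly shorter; [keep] then drops any other
   weight that reached 0, because the induction hypothesis asks for strictly positive weights. *)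
destruct (in_split _ _ Hq) as (c1 & c2 & Ec).
pose (upd := fun p : (R * R) * R => (fst (fst p) - th * snd p, snd (fst p))).
pose (keep := fun p : R * R => if Rlt_dec 0 (fst p) then true else false).
destruct (IH (filter keep (map upd (c1 ++ c2)))) as (l' & L1 & L2 & L3).
{ assert (H1 := filter_length_le keep (map upd (c1 ++ c2))).
  rewrite length_map, length_app in H1.
  rewrite <- E, Ec, length_map, length_app in Hn; simpl in Hn; lia. }
{ intros p Hp; apply filter_In in Hp; destruct Hp as (_ & Hp).
  unfold keep in Hp; destruct (Rlt_dec 0 (fst p)); [assumption | discriminate]. }
exists l'; split; [exact L1|]; split.
- intros p Hp; destruct (L2 p Hp) as (L4 & x & Hx & Ex); split; [exact L4|].
  apply filter_In in Hx; destruct Hx as (Hx & _); apply in_map_iff in Hx.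
  destruct Hx as (y & Ey & Hy); exists (fst y); split.
  + rewrite <- E; apply in_map; rewrite Ec; apply in_app_or in Hy; apply in_or_app; simpl; tauto.
  + rewrite <- Ex, <- Ey; reflexivity.
- intros k Hk; rewrite L3 by exact Hk.
  assert (F : forall a, (forall p, In p a -> 0 <= fst p) ->
     qsum (fun x => x ^ k) (filter keep a) = qsum (fun x => x ^ k) a).
  { induction a as [|p a IHa]; intros Ha; simpl; [reflexivity|].
    assert (Hp := Ha p (or_introl eq_refl)).
    unfold keep at 1; destruct (Rlt_dec 0 (fst p)); simpl; rewrite IHa; try reflexivity;
      try (intros; apply Ha; now right).
    replace (fst p) with 0 by lra; ring. }
  rewrite F.
  2:{ intros p Hp; apply in_map_iff in Hp; destruct Hp as (y & <- & Hy); apply T1.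
      rewrite Ec; apply in_app_or in Hy; apply in_or_app; simpl; tauto. }
  assert (U : forall a, qsum (fun x => x ^ k) (map upd a) = qsum (fun x => x ^ k) (map fst a)
      - th * fold_right (fun p s => snd p * snd (fst p) ^ k + s) 0 a).
  { induction a as [|p a IHa]; simpl; [ring | rewrite IHa; ring]. }
  assert (Z : qsum (fun x => x ^ k) (map upd c) = qsum (fun x => x ^ k) l).
  { rewrite U, E, Hc by exact Hk; ring. }
  assert (Uq : fst (upd q) = 0) by exact T2.
  rewrite <- Z, Ec, !map_app, !qsum_app; cbn [map qsum]; rewrite Uq; ring.
Qed.

(** * Quadrature rules on one panel and on geometric panels *)

Lemma ex_RInt_cont (f : R -> R) a b : (forall x, continuous f x) -> ex_RInt f a b.
Proof. intro H; apply (ex_RInt_continuous (V := R_CompleteNormedModule)); auto. Qed.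

Definition lipschitz_on (f : R -> R) (K a b : R) : Prop :=
  forall x y, a <= x <= b -> a <= y <= b -> Rabs (f x - f y) <= K * Rabs (x - y).

Fixpoint riemann_rule (a h : R) (n : nat) : list (R * R) :=
  match n with
  | O => nil
  | S k => (h, a + h) :: riemann_rule (a + h) h k
  end.

Lemma riemann_rule_spec h n : forall a, 0 < h -> forall p, In p (riemann_rule a h n) ->
  fst p = h /\ a < snd p <= a + INR n * h.
Proof.
induction n as [|n IH]; intros a Hh p; [intros []|].
intros Hp; rewrite S_INR; assert (0 <= INR n) by apply pos_INR.
assert (0 <= INR n * h) by (apply Rmult_le_pos; lra).
destruct Hp as [<-|Hp]; [simpl; lra|].
apply IH in Hp; [lra | exact Hh].
Qed.

Lemma riemann_rule_mass h n : forall a, qsum (fun x => x ^ 0) (riemann_rule a h n) = INR n * h.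
Proof.
induction n as [|n IH]; intro a; [simpl; ring|].
rewrite S_INR; simpl riemann_rule; cbn [qsum]; rewrite IH; simpl; ring.
Qed.

Lemma riemann_rule_err f K h n : forall a, 0 < h -> (forall x, continuous f x) ->
  lipschitz_on f K a (a + INR n * h) ->
  Rabs (RInt f a (a + INR n * h) - qsum f (riemann_rule a h n)) <= INR n * (K * h * h).
Proof.
induction n as [|n IH]; intros a Hh Hc HL.
- simpl; replace (a + 0 * h) with a by ring.
  rewrite RInt_point; unfold zero; simpl; rewrite Rminus_0_r, Rabs_R0; lra.
- assert (Hn : 0 <= INR n) by apply pos_INR.
  assert (Hnh : 0 <= INR n * h) by (apply Rmult_le_pos; lra).
  rewrite S_INR in *.
  replace (a + (INR n + 1) * h) with ((a + h) + INR n * h) in * by ring.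
  rewrite <- (RInt_Chasles f a (a + h)) by (apply ex_RInt_cont, Hc).
  simpl.
  assert (H1 : Rabs (RInt f (a + h) (a + h + INR n * h) - qsum f (riemann_rule (a + h) h n))
    <= INR n * (K * h * h)).
  { apply IH; auto; intros x y Hx Hy; apply HL; lra. }
  assert (H2 : Rabs (RInt f a (a + h) - h * f (a + h)) <= K * h * h).
  { replace (RInt f a (a + h) - h * f (a + h)) with (RInt (fun x => f x - f (a + h)) a (a + h)).
    2:{ rewrite (RInt_minus f (fun _ => f (a + h))).
        - rewrite RInt_const; unfold minus, plus, opp, scal; simpl; unfold mult; simpl; ring.
        - apply ex_RInt_cont, Hc.
        - apply ex_RInt_const. }
    replace (K * h * h) with ((a + h - a) * (K * h)) by ring.
    apply abs_RInt_le_const; [lra| |].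
    - apply ex_RInt_cont; intro x; apply (continuous_minus f (fun _ => f (a + h))); [apply Hc | apply continuous_const].
    - intros x Hx; apply Rle_trans with (K * Rabs (x - (a + h))); [apply HL; lra|].
      assert (0 <= K).
      { assert (H := HL a (a + h) ltac:(lra) ltac:(lra)).
        assert (0 <= Rabs (f a - f (a + h))) by apply Rabs_pos.
        replace (a - (a + h)) with (- h) in H by ring.
        rewrite Rabs_Ropp, (Rabs_right h) in H by lra.
        apply Rmult_le_reg_r with h; lra. }
      apply Rmult_le_compat_l; [assumption|].
      rewrite Rabs_left1; lra. }
  unfold plus; simpl.
  match goal with |- Rabs (?A + ?B - (?C + ?D)) <= _ =>
    replace (A + B - (C + D)) with ((A - C) + (B - D)) by ring end.
  eapply Rle_trans; [apply Rabs_triang|]; lra.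
Qed.

Lemma qsum_abs_le f P eta l : (forall p, In p l -> 0 <= fst p) ->
  (forall p, In p l -> Rabs (f (snd p) - P (snd p)) <= eta) ->
  Rabs (qsum f l - qsum P l) <= eta * qsum (fun x => x ^ 0) l.
Proof.
induction l as [|p l IH]; intros H0 H; simpl; [rewrite Rminus_diag, Rabs_R0; lra|].
assert (H1 := IH (fun p Hp => H0 p (or_intror Hp)) (fun p Hp => H p (or_intror Hp))).
assert (H2 := H p (or_introl eq_refl)); assert (H3 := H0 p (or_introl eq_refl)).
replace (fst p * f (snd p) + qsum f l - (fst p * P (snd p) + qsum P l))
  with (fst p * (f (snd p) - P (snd p)) + (qsum f l - qsum P l)) by ring.
eapply Rle_trans; [apply Rabs_triang|].
rewrite Rabs_mult, (Rabs_right (fst p)) by lra.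
assert (fst p * Rabs (f (snd p) - P (snd p)) <= fst p * eta) by (apply Rmult_le_compat_l; lra).
simpl in H1; lra.
Qed.

(* A positive rule with [m] nodes that integrates polynomials of degree less than [m]
   as a fine Riemann sum does, obtained without orthogonal polynomials. *)
Lemma panel_rule a b m K e : a < b -> (1 <= m)%nat -> 0 < e -> 0 <= K ->
  exists l, (length l <= m)%nat /\ (forall p, In p l -> 0 < fst p /\ a < snd p <= b) /\
  forall f P eta, (forall x, continuous f x) -> lipschitz_on f K a b -> polyn m P ->
    (forall x, a <= x <= b -> Rabs (f x - P x) <= eta) ->
    Rabs (RInt f a b - qsum f l) <= 2 * eta * (b - a) + e.
Proof.
intros Hab Hm He HK.
(* With N > K (b - a)^2 / e cells the Riemann error K (b - a)^2 / N is at most [e]. The reduction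
   makes the node count independent of N. *)
destruct (INR_unbounded (K * (b - a) * (b - a) / e)) as (n & Hn).
pose (N := S n); pose (h := (b - a) / INR N).
assert (HN : 0 < INR N) by (apply lt_0_INR; unfold N; lia).
assert (Hh : 0 < h) by (apply Rdiv_lt_0_compat; lra).
assert (HNh : INR N * h = b - a) by (unfold h; field; lra).
assert (Herr : INR N * (K * h * h) <= e).
{ replace (INR N * (K * h * h)) with (K * (b - a) * (b - a) / INR N).
  2:{ rewrite <- HNh; field; lra. }
  apply Rmult_le_reg_r with (INR N); [exact HN|].
  unfold Rdiv; rewrite Rmult_assoc, Rinv_l, Rmult_1_r by lra.
  apply Rmult_lt_compat_l with (r := e) in Hn; [|exact He].
  replace (e * (K * (b - a) * (b - a) / e)) with (K * (b - a) * (b - a)) in Hn by (field; lra).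
  assert (INR N = INR n + 1) by (unfold N; apply S_INR); nra. }
pose (l0 := riemann_rule a h N).
assert (S0 : forall p, In p l0 -> fst p = h /\ a < snd p <= b).
{ intros p Hp; apply riemann_rule_spec in Hp; [|exact Hh]; rewrite HNh in Hp.
  replace (a + (b - a)) with b in Hp by ring; exact Hp. }
destruct (caratheodory m l0) as (l & L1 & L2 & L3).
{ intros p Hp; apply S0 in Hp; lra. }
exists l; split; [exact L1|]; split.
{ intros p Hp; destruct (L2 p Hp) as (H1 & q & Hq & E); split; [exact H1|].
  rewrite <- E; apply S0, Hq. }
intros f P eta Hc HL HP Hf.
assert (M0 : qsum (fun x => x ^ 0) l0 = b - a).
{ rewrite <- HNh; apply riemann_rule_mass. }
(* As 1 <= m, the total mass is among the preserved moments. Together with positivity it bounds the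
   effect of replacing f by P in either rule by eta (b - a), whence the factor 2. *)
assert (M1 : qsum (fun x => x ^ 0) l = b - a) by (rewrite L3 by lia; exact M0).
assert (A1 := riemann_rule_err f K h N a Hh Hc).
rewrite HNh in A1; replace (a + (b - a)) with b in A1 by ring; specialize (A1 HL); fold l0 in A1.
assert (A2 : Rabs (qsum f l0 - qsum P l0) <= eta * (b - a)).
{ rewrite <- M0; apply qsum_abs_le; intros p Hp; apply S0 in Hp; [lra | apply Hf; lra]. }
assert (A3 : Rabs (qsum f l - qsum P l) <= eta * (b - a)).
{ rewrite <- M1; apply qsum_abs_le; intros p Hp; destruct (L2 p Hp) as (H1 & q & Hq & E); [lra|].
  rewrite <- E; apply Hf; apply S0 in Hq; lra. }
assert (A4 : qsum P l = qsum P l0) by (apply (qsum_polyn m); auto).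
rewrite A4 in A3.
replace (RInt f a b - qsum f l) with
  ((RInt f a b - qsum f l0) + ((qsum f l0 - qsum P l0) - (qsum f l - qsum P l0))) by ring.
assert (T1 := Rabs_triang (RInt f a b - qsum f l0) ((qsum f l0 - qsum P l0) - (qsum f l - qsum P l0))).
assert (T2 := Rabs_triang (qsum f l0 - qsum P l0) (- (qsum f l - qsum P l0))).
rewrite Rabs_Ropp in T2; unfold Rminus at 1 in T2; unfold Rminus in *; lra.
Qed.

(** The error at y is bounded by E at every other point y' of the panel. Hence the largest error
    times the panel length is at most the integral of E there, and the panels add up to one integral
    instead of J times a maximum. *)
Lemma geometric_rule a q m K e J : 0 < a -> 1 < q -> (1 <= m)%nat -> 0 < e -> 0 <= K ->
  exists l, (length l <= J * m)%nat /\
  (forall p, In p l -> 0 < fst p /\ a < snd p <= a * q ^ J) /\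
  forall f E, (forall x, continuous f x) -> (forall x, continuous E x) ->
    lipschitz_on f K a (a * q ^ J) ->
    (forall x, a <= x -> exists P, polyn m P /\
       forall y y', x <= y <= q * x -> x <= y' <= q * x -> Rabs (f y - P y) <= E y') ->
    Rabs (RInt f a (a * q ^ J) - qsum f l) <= 2 * RInt E a (a * q ^ J) + INR J * e.
Proof.
intros Ha Hq Hm He HK; induction J as [|J IH].
- exists nil; split; [simpl; lia|]; split; [intros p []|].
  intros f E _ _ _ _; simpl; rewrite Rmult_1_r, !RInt_point; unfold zero; simpl.
  rewrite Rminus_diag, Rabs_R0; lra.
- destruct IH as (l1 & A1 & A2 & A3).
  assert (Hp : 1 <= q ^ J) by (apply pow_R1_Rle; lra).
  set (x := a * q ^ J) in *.
  assert (Hx : a <= x) by (unfold x; nra).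
  assert (Hqx : x < q * x) by nra.
  replace (a * q ^ S J) with (q * x) by (unfold x; simpl; ring).
  destruct (panel_rule x (q * x) m K e Hqx Hm He HK) as (l2 & B1 & B2 & B3).
  exists (l1 ++ l2); split; [rewrite length_app; simpl; lia|]; split.
  { intros p Hp'; apply in_app_or in Hp'; destruct Hp' as [Hp'|Hp'];
      [apply A2 in Hp' | apply B2 in Hp']; lra. }
  intros f E Hf HE HL HP.
  assert (C1 : Rabs (RInt f a x - qsum f l1) <= 2 * RInt E a x + INR J * e).
  { apply A3; auto; intros u v Hu Hv; apply HL; lra. }
  destruct (HP x Hx) as (P & HP1 & HP2).
  (* The constant that separates all errors from all values of E is the supremum of the errors. *)
  assert (Hsup : exists eta, (forall y, x <= y <= q * x -> Rabs (f y - P y) <= eta) /\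
    (forall y, x <= y <= q * x -> eta <= E y)).
  { destruct (completeness (fun r => exists y, x <= y <= q * x /\ r = Rabs (f y - P y)))
      as (eta & U1 & U2).
    - exists (E x); intros r (y & Hy & ->); apply HP2; lra.
    - exists (Rabs (f x - P x)), x; split; [lra | reflexivity].
    - exists eta; split.
      + intros y Hy; apply U1; exists y; tauto.
      + intros y' Hy'; apply U2; intros r (y & Hy & ->); auto. }
  destruct Hsup as (eta & U1 & U2).
  assert (C2 : Rabs (RInt f x (q * x) - qsum f l2) <= 2 * eta * (q * x - x) + e).
  { apply (B3 f P); auto; intros u v Hu Hv; apply HL; lra. }
  assert (C3 : eta * (q * x - x) <= RInt E x (q * x)).
  { replace (eta * (q * x - x)) with (RInt (fun _ => eta) x (q * x)).
    - apply RInt_le; [lra | apply ex_RInt_const | apply ex_RInt_cont, HE | intros; apply U2; lra].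
    - rewrite RInt_const; unfold scal; simpl; unfold mult; simpl; ring. }
  rewrite <- (RInt_Chasles f a x) by (apply ex_RInt_cont; assumption).
  rewrite <- (RInt_Chasles E a x) by (apply ex_RInt_cont; assumption).
  unfold plus; simpl plus; rewrite qsum_app, S_INR; simpl.
  match goal with |- Rabs (?A + ?B - (?C + ?D)) <= _ =>
    replace (A + B - (C + D)) with ((A - C) + (B - D)) by ring end.
  eapply Rle_trans; [apply Rabs_triang|]; lra.
Qed.

(** * Taylor polynomials of the complex exponential *)

(* Coquelicot states equations at the carrier of a structure, where [ring] does not see [R]. *)
Ltac as_R_eq := match goal with |- @eq _ ?a ?b => change (@eq R a b) end.

Fixpoint Cpow_nat (u : Cx) (k : nat) : Cx :=
  match k with O => RtoC 1 | S k => Cmul u (Cpow_nat u k) end.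

(** The partial sum of e^{s u} with p terms. The real parameter [s] allows the remainder to be
    differentiated along the segment from 0 to u. *)
Fixpoint Ctaylor (p : nat) (s : R) (u : Cx) : Cx :=
  match p with
  | O => RtoC 0
  | S k => Cadd (Ctaylor k s u) (Cmul (RtoC (s ^ k / INR (fact k))) (Cpow_nat u k))
  end.

Lemma Ctaylor_0 p u : Ctaylor (S p) 0 u = RtoC 1.
Proof.
induction p as [|p IH].
- cbn; unfold Cadd, Cmul, RtoC; cbn; f_equal; field.
- change (Ctaylor (S (S p)) 0 u) with
    (Cadd (Ctaylor (S p) 0 u) (Cmul (RtoC (0 ^ S p / INR (fact (S p)))) (Cpow_nat u (S p)))).
  rewrite IH, pow_i by lia; unfold Cadd, Cmul, RtoC, Rdiv; cbn [fst snd]; f_equal; ring.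
Qed.

Lemma is_derive_Ctaylor p u s :
  is_derive (fun s => fst (Ctaylor (S p) s u)) s (fst (Cmul u (Ctaylor p s u))) /\
  is_derive (fun s => snd (Ctaylor (S p) s u)) s (snd (Cmul u (Ctaylor p s u))).
Proof.
induction p as [|p [IH1 IH2]].
- split; cbn; auto_derive; auto; ring.
- assert (Hf : INR (fact (S p)) = INR (S p) * INR (fact p)) by (rewrite <- mult_INR; reflexivity).
  assert (H0 : INR (fact p) <> 0) by apply INR_fact_neq_0.
  assert (H1 : INR (S p) <> 0) by (apply not_0_INR; lia).
  assert (D : is_derive (fun s => s ^ S p / INR (fact (S p))) s (s ^ p / INR (fact p))).
  { revert Hf; generalize (INR (fact (S p))); intros F HF.
    auto_derive; [exact I|].
    change (match p with O => 1 | S _ => INR p + 1 end) with (INR (S p)).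
    rewrite HF; simpl pred; field; split; assumption. }
  split.
  + apply (is_derive_ext (fun s => fst (Ctaylor (S p) s u)
       + s ^ S p / INR (fact (S p)) * fst (Cpow_nat u (S p)))).
    { intro t; as_R_eq; cbn [Ctaylor]; unfold Cadd, Cmul, RtoC; cbn [fst snd]; ring. }
    evar_last.
    { apply @is_derive_plus; [exact IH1 | apply @is_derive_mult; [exact D | apply is_derive_const |]].
      intros; apply Rmult_comm. }
    cbn [Ctaylor Cpow_nat]; unfold plus, mult, zero, Cadd, Cmul, RtoC; cbn; unfold Rdiv; ring.
  + apply (is_derive_ext (fun s => snd (Ctaylor (S p) s u)
       + s ^ S p / INR (fact (S p)) * snd (Cpow_nat u (S p)))).
    { intro t; as_R_eq; cbn [Ctaylor]; unfold Cadd, Cmul, RtoC; cbn [fst snd]; ring. }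
    evar_last.
    { apply @is_derive_plus; [exact IH2 | apply @is_derive_mult; [exact D | apply is_derive_const |]].
      intros; apply Rmult_comm. }
    cbn [Ctaylor Cpow_nat]; unfold plus, mult, zero, Cadd, Cmul, RtoC; cbn; unfold Rdiv; ring.
Qed.

Lemma Cmod_sqr z : Cmod z * Cmod z = fst z ^ 2 + snd z ^ 2.
Proof. unfold Cmod; apply sqrt_sqrt; nra. Qed.

Lemma Cmod_nonneg z : 0 <= Cmod z.
Proof. apply sqrt_pos. Qed.

Lemma Cmod_mul z w : Cmod (Cmul z w) = Cmod z * Cmod w.
Proof.
unfold Cmod; rewrite <- sqrt_mult by nra; f_equal; unfold Cmul; cbn [fst snd]; ring.
Qed.

Lemma Cauchy_Schwarz2 z w : fst z * fst w + snd z * snd w <= Cmod z * Cmod w.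
Proof.
assert (H := Cmod_nonneg z); assert (H' := Cmod_nonneg w).
apply Rle_trans with (Rabs (fst z * fst w + snd z * snd w)); [apply Rle_abs|].
apply Rsqr_incr_0; [|apply Rabs_pos | apply Rmult_le_pos; assumption].
rewrite <- Rsqr_abs; unfold Rsqr.
replace (Cmod z * Cmod w * (Cmod z * Cmod w)) with ((Cmod z * Cmod z) * (Cmod w * Cmod w)) by ring.
rewrite !Cmod_sqr; assert (0 <= (fst z * snd w - snd z * fst w) ^ 2) by apply pow2_ge_0; nra.
Qed.

Lemma Cmod_Cexp z : Cmod (Cexp z) = exp (fst z).
Proof.
unfold Cmod, Cexp; cbn [fst snd].
transitivity (sqrt (Rsqr (exp (fst z)))); [f_equal | apply sqrt_Rsqr, Rlt_le, exp_pos].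
transitivity (exp (fst z) ^ 2 * (Rsqr (sin (snd z)) + Rsqr (cos (snd z)))).
- unfold Rsqr; ring.
- rewrite sin2_cos2; unfold Rsqr; ring.
Qed.

Lemma fst_le_Cmod z : fst z <= Cmod z.
Proof.
apply Rle_trans with (Rabs (fst z)); [apply Rle_abs|].
apply Rsqr_incr_0; [|apply Rabs_pos | apply Cmod_nonneg].
rewrite <- Rsqr_abs; unfold Rsqr; rewrite Cmod_sqr; nra.
Qed.

Lemma Rabs_snd_le_Cmod z : Rabs (snd z) <= Cmod z.
Proof.
apply Rsqr_incr_0; [|apply Rabs_pos | apply Cmod_nonneg].
rewrite <- Rsqr_abs; unfold Rsqr; rewrite Cmod_sqr; nra.
Qed.

Lemma decreasing_from_0 (f df : R -> R) s : 0 <= s ->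
  (forall x, is_derive f x (df x)) -> (forall x, 0 <= x -> df x <= 0) -> f s <= f 0.
Proof.
intros Hs Hd Hn.
destruct (MVT_gen f 0 s df) as (c & Hc & E).
- intros; apply Hd.
- intros x _; apply continuity_pt_filterlim.
  apply (ex_derive_continuous (K := R_AbsRing) (V := R_NormedModule)); exists (df x); apply Hd.
- rewrite Rmin_left, Rmax_right in Hc by lra.
  assert (H := Hn c ltac:(lra)).
  assert (0 <= - df c * (s - 0)) by (apply Rmult_le_pos; lra); lra.
Qed.

(* Bounding the tail of the series of exp by e^{-p} times the series at e|u| avoids factorials. *)
Lemma exp_Taylor_remainder u p : forall s, 0 <= s ->
  Cmod (Csub (Cexp (Cmul (RtoC s) u)) (Ctaylor p s u)) <= exp (- INR p + exp 1 * Cmod u * s).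
Proof.
assert (Hu := Cmod_nonneg u).
assert (He : 1 <= exp 1) by (apply Rle_trans with (1 + 1); [lra | apply exp_ineq1_le]).
induction p as [|p IH]; intros s Hs.
- replace (Csub _ _) with (Cexp (Cmul (RtoC s) u)).
  2:{ unfold Csub, Ctaylor, RtoC; destruct (Cexp _); cbn; f_equal; ring. }
  rewrite Cmod_Cexp; unfold Cmul, RtoC; cbn [fst snd]; replace (- INR 0) with 0 by (simpl; ring).
  assert (H : s * fst u - 0 * snd u <= 0 + exp 1 * Cmod u * s).
  { assert (fst u <= Cmod u) by apply fst_le_Cmod.
    assert (Cmod u <= exp 1 * Cmod u) by nra. nra. }
  destruct H as [H|H]; [left; now apply exp_increasing | right; now rewrite H].
- set (g := fun p s => Csub (Cexp (Cmul (RtoC s) u)) (Ctaylor p s u)) in *.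
  change (Cmod (g (S p) s) <= exp (- INR (S p) + exp 1 * Cmod u * s)).
  assert (D : forall x, is_derive (fun x => fst (g (S p) x)) x (fst (Cmul u (g p x))) /\
                        is_derive (fun x => snd (g (S p) x)) x (snd (Cmul u (g p x)))).
  { intro x; destruct (is_derive_Ctaylor p u x) as [D1 D2]; split.
    - apply (is_derive_ext (fun x => exp (x * fst u) * cos (x * snd u) - fst (Ctaylor (S p) x u))).
      { intro t; as_R_eq; unfold g, Csub, Cexp, Cmul, RtoC; cbn [fst snd].
        f_equal; f_equal; [f_equal | f_equal]; ring. }
      evar_last.
      { apply @is_derive_minus; [|exact D1]. auto_derive; [exact I | reflexivity]. }
      as_R_eq; unfold minus, plus, opp; cbn [AbelianMonoid.sort]; simpl.
      unfold g, Csub, Cexp, Cmul, RtoC; cbn [fst snd].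
      replace (x * snd u + 0 * fst u) with (x * snd u) by ring.
      replace (x * fst u - 0 * snd u) with (x * fst u) by ring. ring.
    - apply (is_derive_ext (fun x => exp (x * fst u) * sin (x * snd u) - snd (Ctaylor (S p) x u))).
      { intro t; as_R_eq; unfold g, Csub, Cexp, Cmul, RtoC; cbn [fst snd].
        f_equal; f_equal; [f_equal | f_equal]; ring. }
      evar_last.
      { apply @is_derive_minus; [|exact D2]. auto_derive; [exact I | reflexivity]. }
      as_R_eq; unfold minus, plus, opp; cbn [AbelianMonoid.sort]; simpl.
      unfold g, Csub, Cexp, Cmul, RtoC; cbn [fst snd].
      replace (x * snd u + 0 * fst u) with (x * snd u) by ring.
      replace (x * fst u - 0 * snd u) with (x * fst u) by ring. ring. }
  (* The mean value inequality for a planar curve: the remainder is projected on its own value [v]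
     at [s], which leaves a real function of x to compare with |v| B. Its derivative is nonpositive
     by Cauchy-Schwarz and the induction hypothesis, the factor e in B' = e |u| B compensating the
     extra e^{-1}. *)
  set (v := g (S p) s).
  set (B := fun x => exp (- INR (S p) + exp 1 * Cmod u * x)).
  change (Cmod v <= B s).
  assert (Hv := Cmod_nonneg v).
  assert (HB : forall x, B x = exp (-1) * exp (- INR p + exp 1 * Cmod u * x)).
  { intro x; unfold B; rewrite <- exp_plus; f_equal; rewrite S_INR; ring. }
  assert (E1 : exp (-1) * exp 1 = 1).
  { rewrite <- exp_plus; replace (-1 + 1) with 0 by ring; apply exp_0. }
  assert (F : fst v * fst (g (S p) s) + snd v * snd (g (S p) s) - Cmod v * B s
     <= fst v * fst (g (S p) 0) + snd v * snd (g (S p) 0) - Cmod v * B 0).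
  { apply (decreasing_from_0
      (fun x => fst v * fst (g (S p) x) + snd v * snd (g (S p) x) - Cmod v * B x)
      (fun x => fst v * fst (Cmul u (g p x)) + snd v * snd (Cmul u (g p x))
          - Cmod v * (exp 1 * Cmod u * B x)) s Hs).
    - intro x; destruct (D x) as [D1 D2].
      apply @is_derive_minus; [apply @is_derive_plus|]; apply is_derive_scal; try assumption.
      unfold B; generalize (INR (S p)) (exp 1) (Cmod u); intros; auto_derive; [exact I | ring].
    - intros x Hx.
      assert (H1 := Cauchy_Schwarz2 v (Cmul u (g p x))); rewrite Cmod_mul in H1.
      assert (H2 := IH x Hx); fold (g p x) in H2.
      assert (H3 : exp 1 * Cmod u * B x = Cmod u * exp (- INR p + exp 1 * Cmod u * x)).
      { rewrite HB.
        replace (exp 1 * Cmod u * (exp (-1) * exp (- INR p + exp 1 * Cmod u * x)))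
          with ((exp (-1) * exp 1) * (Cmod u * exp (- INR p + exp 1 * Cmod u * x))) by ring.
        rewrite E1; ring. }
      rewrite H3.
      assert (Cmod u * Cmod (g p x) <= Cmod u * exp (- INR p + exp 1 * Cmod u * x)).
      { apply Rmult_le_compat_l; assumption. }
      assert (Cmod v * (Cmod u * Cmod (g p x)) <= Cmod v * (Cmod u * exp (- INR p + exp 1 * Cmod u * x))).
      { apply Rmult_le_compat_l; assumption. }
      lra. }
  fold v in F.
  assert (G0 : g (S p) 0 = RtoC 0).
  { unfold g; rewrite Ctaylor_0; unfold Csub, Cexp, Cmul, RtoC; cbn [fst snd].
    rewrite !Rmult_0_l, Rminus_0_r, Rplus_0_l, exp_0, cos_0, sin_0; f_equal; ring. }
  rewrite G0 in F; cbn [fst snd RtoC] in F.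
  assert (HV := Cmod_sqr v).
  assert (0 < B 0) by apply exp_pos.
  assert (0 <= Cmod v * B 0) by (apply Rmult_le_pos; lra).
  assert (Cmod v * Cmod v <= Cmod v * B s) by (simpl in *; lra).
  destruct (Rle_lt_dec (Cmod v) 0) as [Hz|Hz].
  + apply Rle_trans with 0; [exact Hz | apply Rlt_le, exp_pos].
  + apply Rmult_le_reg_l with (Cmod v); assumption.
Qed.

(** * Powers of t as exponential sums *)

Definition cpolyn (m : nat) (g : R -> Cx) : Prop :=
  polyn m (fun x => fst (g x)) /\ polyn m (fun x => snd (g x)).

Lemma cpolyn_le m n g : (m <= n)%nat -> cpolyn m g -> cpolyn n g.
Proof. intros H [H1 H2]; split; apply polyn_le with m; assumption. Qed.

Lemma cpolyn_const c : cpolyn 1 (fun _ => c).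
Proof. split; apply polyn_const. Qed.

Lemma cpolyn_add m g h : cpolyn m g -> cpolyn m h -> cpolyn m (fun x => Cadd (g x) (h x)).
Proof.
intros [G1 G2] [H1 H2]; split; cbn.
- apply polyn_ext with (fun x => 1 * fst (g x) + 1 * fst (h x)); [intro; ring | now apply polyn_lin].
- apply polyn_ext with (fun x => 1 * snd (g x) + 1 * snd (h x)); [intro; ring | now apply polyn_lin].
Qed.

Lemma cpolyn_mul m n g h : cpolyn m g -> cpolyn n h -> cpolyn (m + n) (fun x => Cmul (g x) (h x)).
Proof.
intros [G1 G2] [H1 H2]; split; cbn.
- apply polyn_ext with (fun x => 1 * (fst (g x) * fst (h x)) + (-1) * (snd (g x) * snd (h x)));
    [intro; ring | apply polyn_lin; now apply polyn_mul].
- apply polyn_ext with (fun x => 1 * (fst (g x) * snd (h x)) + 1 * (snd (g x) * fst (h x)));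
    [intro; ring | apply polyn_lin; now apply polyn_mul].
Qed.

Lemma cpolyn_Ctaylor n u p s : cpolyn n u -> cpolyn (n * p + 2) (fun x => Ctaylor p s (u x)).
Proof.
intro Hu.
assert (Hpow : forall k, cpolyn (n * k + 1) (fun x => Cpow_nat (u x) k)).
{ induction k as [|k IH]; cbn [Cpow_nat].
  - apply cpolyn_le with 1%nat; [lia | apply cpolyn_const].
  - apply cpolyn_le with (n + (n * k + 1))%nat; [lia | now apply (cpolyn_mul n)]. }
induction p as [|p IH]; cbn [Ctaylor].
- apply cpolyn_le with 1%nat; [lia | apply cpolyn_const].
- apply cpolyn_add; [apply cpolyn_le with (n * p + 2)%nat; [lia | exact IH]|].
  apply cpolyn_le with (1 + (n * p + 1))%nat; [lia|].
  apply (cpolyn_mul 1 _ (fun _ => _)); [apply cpolyn_const | apply Hpow].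
Qed.

(** * Calculus lemmas and Gaussian moments *)

Lemma lipschitz_of_derive (f df : R -> R) K a b :
  (forall x, is_derive f x (df x)) -> (forall x, a <= x <= b -> Rabs (df x) <= K) ->
  lipschitz_on f K a b.
Proof.
intros Hd HK x y Hx Hy.
destruct (MVT_gen f y x df) as (c & Hc & E).
- intros; apply Hd.
- intros z _; apply continuity_pt_filterlim.
  apply (ex_derive_continuous (K := R_AbsRing) (V := R_NormedModule)); exists (df z); apply Hd.
- rewrite E, Rabs_mult; apply Rmult_le_compat_r; [apply Rabs_pos | apply HK].
  unfold Rmin, Rmax in Hc; destruct (Rle_dec y x); lra.
Qed.

Lemma derive_continuous (f df : R -> R) : (forall x, is_derive f x (df x)) -> forall x, continuous f x.
Proof.
intros Hd x; apply (ex_derive_continuous (K := R_AbsRing) (V := R_NormedModule)).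
exists (df x); apply Hd.
Qed.

Lemma RInt_FTC (F f : R -> R) a b :
  (forall x, is_derive F x (f x)) -> (forall x, continuous f x) -> RInt f a b = F b - F a.
Proof.
intros HF Hf; apply is_RInt_unique.
apply (is_RInt_derive (V := R_CompleteNormedModule) F f); auto.
Qed.

Lemma exp_le x y : x <= y -> exp x <= exp y.
Proof. intros [H|H]; [left; now apply exp_increasing | right; now rewrite H]. Qed.

Lemma exp_pow x n : exp x ^ n = exp (INR n * x).
Proof.
induction n as [|n IH]; [simpl; now rewrite Rmult_0_l, exp_0|].
rewrite S_INR; simpl; rewrite IH, <- exp_plus; f_equal; ring.
Qed.

(** This trades any power against a quarter of the Gaussian exponent and leaves the integrable
    weight 1/(1 + v^2). It follows from y^n <= e^{n y} at y = v^2/(4n). *)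
Lemma pow_le_gauss d : exists C, 1 <= C /\
  forall v, 0 <= v -> v ^ d * (1 + v ^ 2) <= C * exp (v ^ 2 / 4).
Proof.
set (n := S (S d)).
assert (Hn : 1 <= INR n) by (unfold n; rewrite S_INR; assert (0 <= INR (S d)) by apply pos_INR; lra).
assert (H4 : 1 <= (4 * INR n) ^ n) by (apply pow_R1_Rle; lra).
exists (2 * (4 * INR n) ^ n); split; [lra|]; intros v Hv.
assert (He : 1 <= exp (v ^ 2 / 4)).
{ apply Rle_trans with (1 + v ^ 2 / 4); [assert (0 <= v ^ 2) by apply pow2_ge_0; lra | apply exp_ineq1_le]. }
destruct (Rle_lt_dec v 1) as [H1|H1].
- assert (v ^ d <= 1) by (rewrite <- (pow1 d); apply pow_incr; lra).
  assert (0 <= v ^ d) by (apply pow_le; lra).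
  assert (v ^ 2 <= 1) by nra. assert (0 <= v ^ 2) by nra. nra.
- assert (Hd : 0 <= v ^ d) by (apply pow_le; lra).
  assert (E1 : v ^ d * (1 + v ^ 2) <= 2 * v ^ n).
  { unfold n; replace (v ^ S (S d)) with (v ^ d * v ^ 2) by (simpl; ring).
    assert (1 <= v ^ 2) by nra. nra. }
  assert (E2 : v ^ n <= (v ^ 2) ^ n) by (apply pow_incr; nra).
  assert (E3 : (v ^ 2 / (4 * INR n)) ^ n <= exp (v ^ 2 / 4)).
  { replace (v ^ 2 / 4) with (INR n * (v ^ 2 / (4 * INR n))) by (field; lra).
    rewrite <- exp_pow; apply pow_incr; split.
    - apply Rdiv_le_0_compat; [apply pow2_ge_0 | lra].
    - apply Rle_trans with (1 + v ^ 2 / (4 * INR n)); [lra | apply exp_ineq1_le]. }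
  assert (E4 : (v ^ 2) ^ n = (4 * INR n) ^ n * (v ^ 2 / (4 * INR n)) ^ n).
  { rewrite <- Rpow_mult_distr; f_equal; field; lra. }
  assert ((v ^ 2) ^ n <= (4 * INR n) ^ n * exp (v ^ 2 / 4)).
  { rewrite E4; apply Rmult_le_compat_l; lra. }
  lra.
Qed.

(** The integrand is dominated by a multiple of 1/(1 + (tau y)^2), whose primitive is an arctangent
    and thus bounded, so the estimate is uniform in the interval without improper integrals. The
    quarter in the exponent is what the panel estimates leave. *)
Lemma gauss_moment_le d : exists C, 1 <= C /\ forall tau a b, 0 < tau -> 0 <= a <= b ->
  RInt (fun y => y ^ d * exp (- (tau * y) ^ 2 / 4)) a b <= C / tau ^ S d.
Proof.
destruct (pow_le_gauss d) as (C & HC & H); exists (2 * C); split; [lra|].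
intros tau a b Ht [Ha Hb].
assert (Htd : 0 < tau ^ d) by now apply pow_lt.
assert (cont : forall x, continuous (fun y => y ^ d * exp (- (tau * y) ^ 2 / 4)) x).
{ intro x; apply (ex_derive_continuous (K := R_AbsRing) (V := R_NormedModule)); auto_derive; exact I. }
assert (D : forall x, is_derive (fun y => C / tau ^ S d * atan (tau * y)) x (C / tau ^ d * / (1 + (tau * x) ^ 2))).
{ intro x; evar_last.
  - apply is_derive_scal.
    apply (is_derive_comp atan (fun y => tau * y)); [apply is_derive_Reals, derivable_pt_lim_atan |].
    auto_derive; [exact I | reflexivity].
  - as_R_eq; unfold scal; simpl; unfold mult; simpl; field.
    split; [nra|]; split; lra. }
assert (cont' : forall x, continuous (fun x => C / tau ^ d * / (1 + (tau * x) ^ 2)) x).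
{ intro x; apply (ex_derive_continuous (K := R_AbsRing) (V := R_NormedModule)); auto_derive; nra. }
apply Rle_trans with (RInt (fun x => C / tau ^ d * / (1 + (tau * x) ^ 2)) a b).
- apply RInt_le; [lra | now apply ex_RInt_cont | now apply ex_RInt_cont |].
  intros y Hy.
  assert (Hv : 0 <= tau * y) by (apply Rmult_le_pos; lra).
  assert (H1 := H (tau * y) Hv); rewrite Rpow_mult_distr in H1 at 1.
  assert (H2 : 0 < 1 + (tau * y) ^ 2) by nra.
  assert (E1 : exp ((tau * y) ^ 2 / 4) * exp (- (tau * y) ^ 2 / 4) = 1).
  { rewrite <- exp_plus, <- exp_0; f_equal; field. }
  assert (E0 := exp_pos (- (tau * y) ^ 2 / 4)).
  apply Rmult_le_reg_l with (tau ^ d * (1 + (tau * y) ^ 2)); [now apply Rmult_lt_0_compat|].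
  replace (tau ^ d * (1 + (tau * y) ^ 2) * (C / tau ^ d * / (1 + (tau * y) ^ 2))) with C
    by (field; split; nra).
  apply Rmult_le_compat_r with (r := exp (- (tau * y) ^ 2 / 4)) in H1; [|lra].
  replace (C * exp ((tau * y) ^ 2 / 4) * exp (- (tau * y) ^ 2 / 4)) with C in H1
    by (rewrite Rmult_assoc, E1; ring).
  lra.
- rewrite (RInt_FTC (fun y => C / tau ^ S d * atan (tau * y))); [|exact D | exact cont'].
  assert (B1 := atan_bound (tau * b)).
  assert (B2 : 0 <= atan (tau * a)).
  { destruct (Req_dec a 0) as [->|Hn]; [rewrite Rmult_0_r, atan_0; lra|].
    rewrite <- atan_0; apply Rlt_le, atan_increasing, Rmult_lt_0_compat; lra. }
  assert (P4 := PI_4).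
  assert (0 < C / tau ^ S d) by (apply Rdiv_lt_0_compat; [lra | now apply pow_lt]).
  replace (2 * C / tau ^ S d) with (C / tau ^ S d * 2) by (unfold Rdiv; ring).
  nra.
Qed.

(* Ratio of the geometric panels: close enough to 1 for the Gaussian decay of the integrand to
   absorb the majorant of its Taylor remainder on a panel. *)
Definition ratio := 101 / 100.

Lemma ln_ratio_pos : 0 < ln ratio.
Proof. rewrite <- ln_1; apply ln_increasing; unfold ratio; lra. Qed.

Lemma nat_above x : 0 <= x -> exists n, x <= INR n <= x + 1.
Proof.
intro Hx; destruct (archimed x) as [H1 H2].
assert (0 <= IZR (up x)) by lra.
exists (Z.to_nat (up x)); rewrite INR_IZR_INZ, Z2Nat.id by (apply le_IZR; assumption); lra.
Qed.

Lemma panel_count x : 1 <= x -> exists J, x <= ratio ^ J /\ INR J <= ln x / ln ratio + 1.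
Proof.
intro Hx; assert (H0 := ln_ratio_pos).
assert (Hl : 0 <= ln x) by (rewrite <- ln_1; destruct Hx as [Hx| <-]; [left; apply ln_increasing; lra | lra]).
destruct (nat_above (ln x / ln ratio)) as (J & H1 & H2); [now apply Rdiv_le_0_compat|].
exists J; split; [|exact H2].
rewrite <- (exp_ln x) by lra; rewrite <- (exp_ln ratio) at 1 by (unfold ratio; lra).
rewrite exp_pow; apply exp_le.
apply Rmult_le_reg_r with (/ ln ratio); [now apply Rinv_0_lt_compat|].
rewrite Rmult_assoc, Rinv_r, Rmult_1_r by lra; exact H1.
Qed.

Lemma qsum_map g (w phi : R -> R) l :
  qsum g (map (fun p => (fst p * w (snd p), phi (snd p))) l) = qsum (fun x => w x * g (phi x)) l.
Proof. induction l as [|p l IH]; simpl; [reflexivity | rewrite IH; ring]. Qed.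

Lemma qsum_scal a g l : qsum (fun x => a * g x) l = a * qsum g l.
Proof. induction l as [|p l IH]; simpl; [ring | rewrite IH; ring]. Qed.

Lemma exp_Taylor_remainder1 u p :
  Cmod (Csub (Cexp u) (Ctaylor p 1 u)) <= exp (- INR p + exp 1 * Cmod u).
Proof.
assert (H := exp_Taylor_remainder u p 1 ltac:(lra)).
rewrite Rmult_1_r in H.
replace (Cmul (RtoC 1) u) with u in H; [exact H|].
destruct u; unfold Cmul, RtoC; cbn; f_equal; ring.
Qed.

Lemma Rabs_fst_le_Cmod z : Rabs (fst z) <= Cmod z.
Proof.
apply Rsqr_incr_0; [|apply Rabs_pos | apply Cmod_nonneg].
rewrite <- Rsqr_abs; unfold Rsqr; rewrite Cmod_sqr; nra.
Qed.

Lemma Cmod_le_sum z : Cmod z <= Rabs (fst z) + Rabs (snd z).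
Proof.
assert (H1 := Rabs_pos (fst z)); assert (H2 := Rabs_pos (snd z)).
apply Rsqr_incr_0; [|apply Cmod_nonneg | lra].
unfold Rsqr; rewrite Cmod_sqr, <- (pow2_abs (fst z)), <- (pow2_abs (snd z)); nra.
Qed.

Lemma polyn_quad a b c : polyn 3 (fun x => a + b * x + c * x ^ 2).
Proof.
exists a, (fun x => b + c * x); split; [|intro; ring].
exists b, (fun _ => c); split; [apply polyn_const | intro; ring].
Qed.

Lemma polyn_scal m a g : polyn m g -> polyn m (fun x => a * g x).
Proof.
intro H; apply polyn_ext with (fun x => a * g x + 0 * g x); [intro; ring | now apply polyn_lin].
Qed.

(** Taylor expansion of the Gaussian about the left end x. On a panel |u| <= (1.01^2 - 1) (tau x)^2,
    so with e <= 3 the majorant e^{e |u|} costs at most 0.0603 (tau x)^2 of the available (tau x)^2.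
    The rest exceeds 1.0201 (tau x)^2 / 4, hence (tau y')^2 / 4 for every y' on the panel. *)
Lemma moment_panel d p tau x : 0 < x -> exists P, polyn (d + 3 * p + 3) P /\
  forall y y', x <= y <= ratio * x -> x <= y' <= ratio * x ->
  Rabs (y ^ d * exp (- (tau * y) ^ 2) - P y)
    <= ratio ^ d * exp (- INR p) * (y' ^ d * exp (- (tau * y') ^ 2 / 4)).
Proof.
intro Hx.
pose (u := fun y => (- (tau * y) ^ 2 + (tau * x) ^ 2, 0) : Cx).
exists (fun y => y ^ d * (exp (- (tau * x) ^ 2) * fst (Ctaylor p 1 (u y)))); split.
- replace (d + 3 * p + 3)%nat with (S d + (3 * p + 2))%nat by lia.
  apply polyn_mul; [apply polyn_pow | apply polyn_scal].
  assert (Hu : cpolyn 3 u).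
  { unfold u; split; cbn [fst snd].
    - apply polyn_ext with (fun y => (tau * x) ^ 2 + 0 * y + - tau ^ 2 * y ^ 2); [intro; ring | apply polyn_quad].
    - apply polyn_zero. }
  exact (proj1 (cpolyn_Ctaylor 3 u p 1 Hu)).
- intros y y' Hy Hy'; unfold ratio in Hy, Hy'.
  assert (Hd : 0 <= y ^ d) by (apply pow_le; lra).
  assert (E0 := exp_pos (- (tau * x) ^ 2)).
  assert (E1 : exp (- (tau * y) ^ 2) = exp (- (tau * x) ^ 2) * fst (Cexp (u y))).
  { unfold u, Cexp; cbn [fst snd]; rewrite cos_0, Rmult_1_r, <- exp_plus; f_equal; ring. }
  rewrite E1.
  replace (y ^ d * (exp (- (tau * x) ^ 2) * fst (Cexp (u y))) -
     y ^ d * (exp (- (tau * x) ^ 2) * fst (Ctaylor p 1 (u y))))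
   with (y ^ d * exp (- (tau * x) ^ 2) * fst (Csub (Cexp (u y)) (Ctaylor p 1 (u y))))
   by (unfold Csub; cbn [fst snd]; ring).
  rewrite Rabs_mult, (Rabs_right (y ^ d * exp (- (tau * x) ^ 2)))
    by (apply Rle_ge, Rmult_le_pos; lra).
  assert (H1 := Rabs_fst_le_Cmod (Csub (Cexp (u y)) (Ctaylor p 1 (u y)))).
  assert (H2 := exp_Taylor_remainder1 (u y) p).
  assert (H3 : Cmod (u y) <= 0.0201 * (tau * x) ^ 2).
  { apply Rle_trans with (1 := Cmod_le_sum _); unfold u; cbn [fst snd]; rewrite Rabs_R0.
    replace (- (tau * y) ^ 2 + (tau * x) ^ 2) with (- (tau ^ 2 * (y ^ 2 - x ^ 2))) by ring.
    assert (0 <= y ^ 2 - x ^ 2 <= 0.0201 * x ^ 2) by nra.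
    assert (0 <= tau ^ 2) by apply pow2_ge_0.
    rewrite Rabs_Ropp, Rabs_right by (apply Rle_ge, Rmult_le_pos; lra).
    replace (0.0201 * (tau * x) ^ 2) with (tau ^ 2 * (0.0201 * x ^ 2)) by ring.
    rewrite Rplus_0_r; apply Rmult_le_compat_l; lra. }
  assert (H4 : exp 1 * Cmod (u y) <= 0.0603 * (tau * x) ^ 2).
  { assert (H := exp_le_3); assert (H' := exp_pos 1); assert (H'' := Cmod_nonneg (u y)); nra. }
  assert (H5 : exp (- (tau * x) ^ 2) * exp (- INR p + exp 1 * Cmod (u y))
     <= exp (- INR p) * exp (- (tau * y') ^ 2 / 4)).
  { rewrite <- !exp_plus; apply exp_le.
    assert (Hq : y' ^ 2 <= 1.0201 * x ^ 2) by nra.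
    assert (Ht : 0 <= tau ^ 2) by apply pow2_ge_0.
    replace ((tau * x) ^ 2) with (tau ^ 2 * x ^ 2) in * by ring.
    replace ((tau * y') ^ 2) with (tau ^ 2 * y' ^ 2) by ring.
    assert (tau ^ 2 * y' ^ 2 <= tau ^ 2 * (1.0201 * x ^ 2)) by (apply Rmult_le_compat_l; assumption).
    assert (0 <= tau ^ 2 * x ^ 2) by (apply Rmult_le_pos; [assumption | apply pow2_ge_0]).
    lra. }
  assert (H6 : y ^ d <= ratio ^ d * y' ^ d).
  { rewrite <- Rpow_mult_distr; apply pow_incr; unfold ratio; lra. }
  apply Rle_trans with (y ^ d * (exp (- (tau * x) ^ 2) * exp (- INR p + exp 1 * Cmod (u y)))).
  + rewrite Rmult_assoc; apply Rmult_le_compat_l; [exact Hd|]; apply Rmult_le_compat_l; lra.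
  + apply Rle_trans with (ratio ^ d * y' ^ d * (exp (- INR p) * exp (- (tau * y') ^ 2 / 4))).
    * apply Rmult_le_compat; try assumption; apply Rmult_le_pos; apply Rlt_le, exp_pos.
    * right; ring.
Qed.

Lemma continuous_moment d : forall x, continuous (fun v => v ^ d * exp (- v ^ 2)) x.
Proof. intro x; apply (ex_derive_continuous (K := R_AbsRing) (V := R_NormedModule)); auto_derive; exact I. Qed.

(** A lower bound for the normalising constants, uniform in the cut X: on [0,1] the Gaussian is at
    least 1/e >= 1/3. *)
Lemma moment_low d X : 1 <= X -> / (3 * INR (S d)) <= RInt (fun v => v ^ d * exp (- v ^ 2)) 0 X.
Proof.
intro HX; assert (C := continuous_moment d).
assert (HS : 0 < INR (S d)) by (apply lt_0_INR; lia).
assert (HSd : forall x, x <> 0 -> x * (/ 3 * / x) = / 3) by (intros; field; auto).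
rewrite <- (RInt_Chasles _ 0 1) by (apply ex_RInt_cont, C).
match goal with |- _ <= plus ?A ?B => change (plus A B) with (A + B) end.
assert (H1 : 0 <= RInt (fun v => v ^ d * exp (- v ^ 2)) 1 X).
{ apply RInt_ge_0; [exact HX | now apply ex_RInt_cont |].
  intros; apply Rmult_le_pos; [apply pow_le; lra | apply Rlt_le, exp_pos]. }
assert (D : forall x, is_derive (fun x => / (3 * INR (S d)) * x ^ S d) x (/ 3 * x ^ d)).
{ intro x; revert HS; generalize (eq_refl (INR (S d))); generalize (INR (S d)) at -1.
  intros N EN HN; auto_derive; [exact I|].
  change (match d with O => 1 | S _ => INR d + 1 end) with (INR (S d)); simpl pred.
  rewrite EN; field; lra. }
assert (H2 : / (3 * INR (S d)) <= RInt (fun v => v ^ d * exp (- v ^ 2)) 0 1).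
{ apply Rle_trans with (RInt (fun x => / 3 * x ^ d) 0 1).
  - rewrite (RInt_FTC (fun x => / (3 * INR (S d)) * x ^ S d)); [|exact D|].
    + rewrite pow1, pow_i by lia; lra.
    + intro x; apply (ex_derive_continuous (K := R_AbsRing) (V := R_NormedModule)); auto_derive; exact I.
  - apply RInt_le; [lra | | now apply ex_RInt_cont |].
    + apply ex_RInt_cont; intro x; apply (ex_derive_continuous (K := R_AbsRing) (V := R_NormedModule)); auto_derive; exact I.
    + intros x Hx; rewrite Rmult_comm; apply Rmult_le_compat_l; [apply pow_le; lra|].
      apply Rle_trans with (exp (Ropp 1)); [|apply exp_le; nra].
      rewrite exp_Ropp; apply Rinv_le_contravar; [apply exp_pos | apply exp_le_3]. }
lra.
Qed.

Lemma moment_head d a : 0 <= a <= 1 -> 0 <= RInt (fun v => v ^ d * exp (- v ^ 2)) 0 a <= a.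
Proof.
intro Ha; assert (C := continuous_moment d); split.
- apply RInt_ge_0; [lra | now apply ex_RInt_cont |].
  intros; apply Rmult_le_pos; [apply pow_le; lra | apply Rlt_le, exp_pos].
- apply Rle_trans with (RInt (fun _ => 1) 0 a).
  + apply RInt_le; [lra | now apply ex_RInt_cont | apply ex_RInt_const |].
    intros x Hx; rewrite <- (Rmult_1_l 1); apply Rmult_le_compat.
    * apply pow_le; lra.
    * apply Rlt_le, exp_pos.
    * rewrite <- (pow1 d); apply pow_incr; lra.
    * rewrite <- exp_0; apply exp_le; nra.
  + rewrite RInt_const; unfold scal; simpl; unfold mult; simpl; lra.
Qed.

(** An algebraic tail suffices: a cut of order 1/eta in place of a logarithmic one adds O(log
    (1/eta)) panels. *)
Lemma moment_tail d : exists C, 1 <= C /\ forall a b, 0 < a <= b ->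
  0 <= RInt (fun v => v ^ d * exp (- v ^ 2)) a b <= C / a.
Proof.
destruct (pow_le_gauss d) as (C & HC & H); exists C; split; [exact HC|].
intros a b Hab; assert (Cm := continuous_moment d); split.
- apply RInt_ge_0; [lra | now apply ex_RInt_cont |].
  intros; apply Rmult_le_pos; [apply pow_le; lra | apply Rlt_le, exp_pos].
- assert (I : is_RInt (fun v => C * / v ^ 2) a b (minus (- C / b) (- C / a))).
  { apply (is_RInt_derive (V := R_CompleteNormedModule) (fun v => - C / v) (fun v => C * / v ^ 2)).
    - intros x Hx; rewrite Rmin_left, Rmax_right in Hx by lra; auto_derive; [lra | field; lra].
    - intros x Hx; rewrite Rmin_left, Rmax_right in Hx by lra.
      apply (ex_derive_continuous (K := R_AbsRing) (V := R_NormedModule)); auto_derive; nra. }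
  apply Rle_trans with (RInt (fun v => C * / v ^ 2) a b).
  + apply RInt_le; [lra | now apply ex_RInt_cont | eexists; exact I |].
    intros v Hv; assert (H1 := H v ltac:(lra)).
    assert (0 < v ^ 2) by (apply pow_lt; lra).
    apply Rmult_le_reg_r with (v ^ 2); [assumption|].
    rewrite Rmult_assoc with (r1 := C), Rinv_l, Rmult_1_r by lra.
    assert (H2 : exp (v ^ 2 / 4) * exp (- v ^ 2) <= 1).
    { rewrite <- exp_plus, <- exp_0; apply exp_le; lra. }
    assert (E0 := exp_pos (- v ^ 2)).
    assert (0 <= v ^ d) by (apply pow_le; lra).
    apply Rmult_le_compat_r with (r := exp (- v ^ 2)) in H1; [|lra].
    rewrite (Rmult_assoc C) in H1.
    assert (C * (exp (v ^ 2 / 4) * exp (- v ^ 2)) <= C) by nra.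
    assert (0 <= v ^ d * exp (- v ^ 2)) by (apply Rmult_le_pos; lra).
    nra.
  + rewrite (is_RInt_unique _ _ _ _ I); unfold minus, plus, opp; simpl.
    assert (0 < C / b) by (apply Rdiv_lt_0_compat; lra).
    unfold Rdiv in *; lra.
Qed.

(** Scaling moves [tau] from the integrand to the endpoints, so that one normalising constant serves
    every [tau]. *)
Lemma moment_scale d tau a b : 0 < tau ->
  tau ^ S d * RInt (fun y => y ^ d * exp (- (tau * y) ^ 2)) a b
  = RInt (fun v => v ^ d * exp (- v ^ 2)) (tau * a) (tau * b).
Proof.
intro Ht; replace (tau * a) with (tau * a + 0) by ring; replace (tau * b) with (tau * b + 0) by ring.
rewrite <- (RInt_comp_lin (V := R_CompleteNormedModule) (fun v => v ^ d * exp (- v ^ 2)) tau 0 a b)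
  by (apply ex_RInt_cont, continuous_moment).
transitivity (scal (tau ^ S d) (RInt (fun y => y ^ d * exp (- (tau * y) ^ 2)) a b)); [reflexivity|].
rewrite <- (RInt_scal (V := R_CompleteNormedModule)).
- apply RInt_ext; intros x _; unfold scal; simpl; unfold mult; simpl.
  rewrite Rplus_0_r, Rpow_mult_distr; ring.
- apply ex_RInt_cont; intro x; apply (ex_derive_continuous (K := R_AbsRing) (V := R_NormedModule)); auto_derive; exact I.
Qed.

Lemma ln_ge_1 x : 10 < x -> 1 <= ln x.
Proof.
intro H; rewrite <- (ln_exp 1); apply Rlt_le, ln_increasing; [apply exp_pos|].
assert (H' := exp_le_3); lra.
Qed.

Lemma Rabs_4 a b c d A B C D :
  Rabs a <= A -> Rabs b <= B -> Rabs c <= C -> Rabs d <= D ->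
  Rabs (a + b + c + d) <= A + B + C + D.
Proof.
intros; assert (T1 := Rabs_triang (a + b + c) d); assert (T2 := Rabs_triang (a + b) c).
assert (T3 := Rabs_triang a b); lra.
Qed.

(** The sum represents tau^{-(d+1)} with relative error eta. In the count, the sum of logarithms
    comes from the number of panels and the other factor ln (1/eta) from the degree. *)
Lemma power_exponential_sum d : exists C, 0 < C /\
  forall eta delta T, 0 < eta < 1 / 10 -> 0 < delta -> 1000 * delta <= T ->
  exists l, INR (length l) <= C * ln (1 / eta) * (ln (T / delta) + ln (1 / eta)) /\
    (forall p, In p l -> 0 < fst p /\ 0 < snd p) /\
    forall tau, sqrt delta <= tau <= sqrt T ->
      Rabs (tau ^ S d * qsum (fun lam => exp (- lam * tau ^ 2)) l - 1) <= eta.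
Proof.
destruct (moment_tail d) as (C1 & HC1 & Htail).
destruct (gauss_moment_le d) as (C2 & HC2 & Hmom).
set (kap := / (3 * INR (S d))).
assert (HSd : 1 <= INR (S d)) by (rewrite S_INR; assert (0 <= INR d) by apply pos_INR; lra).
assert (Hkap : 0 < kap) by (apply Rinv_0_lt_compat; lra).
assert (Hkap1 : kap <= 1).
{ unfold kap; rewrite <- Rinv_1; apply Rinv_le_contravar; lra. }
assert (Hqd : 1 <= ratio ^ d) by (apply pow_R1_Rle; unfold ratio; lra).
(* Chosen so that head, tail and Taylor error, (1 + C1 + 2 ratio^d C2) eta / A in all, amount to kap
   eta / 4; the Riemann sums get as much again. *)
set (A := (4 + 4 * C1 + 8 * ratio ^ d * C2) / kap).
assert (HA : A * kap = 4 + 4 * C1 + 8 * ratio ^ d * C2) by (unfold A; field; lra).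
assert (HqC : 1 <= ratio ^ d * C2) by nra.
assert (HA1 : 1 <= A) by nra.
assert (HlA : 0 <= ln A).
{ rewrite <- ln_1; destruct HA1 as [H|<-]; [left; apply ln_increasing; lra | lra]. }
assert (Hlq := ln_ratio_pos).
set (CJ := (2 * ln A + 2) / ln ratio + 1).
set (Cm := INR d + 9 + 3 * ln A).
assert (HCJ : 0 < CJ).
{ unfold CJ; assert (0 < (2 * ln A + 2) / ln ratio) by (apply Rdiv_lt_0_compat; lra); lra. }
assert (HCm : 0 < Cm) by (unfold Cm; assert (0 <= INR d) by apply pos_INR; lra).
exists (CJ * Cm); split; [now apply Rmult_lt_0_compat|].
intros eta delta T Heta Hdelta HT.
set (sd := sqrt delta); set (sT := sqrt T).
assert (Hsd : 0 < sd) by (apply sqrt_lt_R0; lra).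
assert (HsT : 0 < sT) by (apply sqrt_lt_R0; lra).
assert (Esd : delta = sd * sd) by (symmetry; apply sqrt_sqrt; lra).
assert (EsT : T = sT * sT) by (symmetry; apply sqrt_sqrt; lra).
assert (HsdT : sd <= sT) by (apply sqrt_le_1_alt; lra).
set (L := ln (1 / eta)); set (Lam := ln (T / delta)).
assert (HL : 1 <= L).
{ apply ln_ge_1; apply Rmult_lt_reg_r with eta; [lra|].
  replace (1 / eta * eta) with 1 by (field; lra); lra. }
assert (HLam : 1 <= Lam).
{ apply ln_ge_1; apply Rmult_lt_reg_r with delta; [lra|].
  replace (T / delta * delta) with T by (field; lra); lra. }
(* The range needed: it starts at a = eta / (A sT), so that tau a <= eta / A for the largest tau,
   and reaches X with tau X >= A / eta for the smallest. *)
set (rho := (A / eta) * (A / eta) * (sT / sd)).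
assert (HAe : 1 <= A / eta).
{ apply Rmult_le_reg_r with eta; [lra|]; replace (A / eta * eta) with A by (field; lra); lra. }
assert (Hst : 1 <= sT / sd).
{ apply Rmult_le_reg_r with sd; [lra|]; replace (sT / sd * sd) with sT by (field; lra); lra. }
assert (Hrho : 1 <= rho) by (unfold rho; assert (1 <= A / eta * (A / eta)) by nra; nra).
assert (ElnA : ln (A / eta) = ln A + L).
{ unfold L; rewrite <- ln_mult; [f_equal; field; lra | lra | apply Rdiv_lt_0_compat; lra]. }
assert (Elnst : ln (sT / sd) = Lam / 2).
{ unfold Lam; rewrite Esd, EsT; replace (sT * sT / (sd * sd)) with ((sT / sd) * (sT / sd)) by (field; lra).
  rewrite ln_mult by lra; lra. }
assert (Elnrho : ln rho = 2 * ln A + 2 * L + Lam / 2).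
{ unfold rho; rewrite !ln_mult by nra; rewrite ElnA, Elnst; ring. }
destruct (panel_count rho Hrho) as (J & HJ1 & HJ2).
destruct (nat_above (ln A + L)) as (p & Hp1 & Hp2); [lra|].
set (a := eta / (A * sT)).
assert (Ha : 0 < a) by (apply Rdiv_lt_0_compat; [lra | apply Rmult_lt_0_compat; lra]).
assert (Eas : a * sT = eta / A) by (unfold a; field; split; lra).
set (X := a * ratio ^ J).
assert (HX : A / eta <= sd * X).
{ apply Rle_trans with (sd * (a * rho)).
  - right; unfold rho, a; field; repeat split; lra.
  - apply Rmult_le_compat_l; [lra|]; apply Rmult_le_compat_l; lra. }
assert (HaX : a <= X).
{ unfold X; assert (1 <= ratio ^ J) by (apply pow_R1_Rle; unfold ratio; lra); nra. }
assert (EX : X = a * ratio ^ J) by reflexivity; clearbody X.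
assert (HJ0 : 0 <= INR J) by apply pos_INR.
set (m := (d + 3 * p + 3)%nat).
pose (Lip := INR d * X ^ pred d + X ^ d * (2 * sT * sT * X)).
assert (HLip : 0 <= Lip).
{ unfold Lip; apply Rplus_le_le_0_compat; apply Rmult_le_pos.
  - apply pos_INR.
  - apply pow_le; lra.
  - apply pow_le; lra.
  - repeat apply Rmult_le_pos; lra. }
(* Each of the J panels contributes [e], later multiplied by tau^{d+1} <= sT^{d+1}. *)
set (e := kap * eta / (4 * sT ^ S d * (INR J + 1))).
assert (HsTd : 0 < sT ^ S d) by now apply pow_lt.
assert (He : 0 < e).
{ apply Rdiv_lt_0_compat; [nra|]; apply Rmult_lt_0_compat; [apply Rmult_lt_0_compat|]; lra. }
destruct (geometric_rule a ratio m Lip e J Ha ltac:(unfold ratio; lra) ltac:(unfold m; lia) He HLip)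
  as (l & L1 & L2 & L3).
rewrite <- EX in L2, L3.
(* The endpoint belongs to the largest tau, so K contains [tau a, tau X] for every admissible tau,
   and the two missing pieces are the head and the tail. *)
set (K := RInt (fun v => v ^ d * exp (- v ^ 2)) 0 (sT * X)).
assert (HsX : 1 <= sT * X) by (assert (sd * X <= sT * X) by (apply Rmult_le_compat_r; lra); lra).
assert (HK : kap <= K) by now apply moment_low.
exists (map (fun q => (fst q * (snd q ^ d / K), snd q ^ 2)) l); split; [|split].
- rewrite length_map.
  apply Rle_trans with (INR (J * m)); [now apply le_INR|].
  rewrite mult_INR.
  assert (B1 : INR J <= CJ * (Lam + L)).
  { apply Rle_trans with (1 := HJ2); rewrite Elnrho; unfold CJ.
    rewrite Rmult_plus_distr_r; apply Rplus_le_compat; [|lra].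
    unfold Rdiv; rewrite (Rmult_comm _ (/ ln ratio)), (Rmult_comm _ (/ ln ratio)), Rmult_assoc.
    apply Rmult_le_compat_l; [apply Rlt_le, Rinv_0_lt_compat; lra | nra]. }
  assert (B2 : INR m <= Cm * L).
  { unfold m, Cm; rewrite !plus_INR, mult_INR; replace (INR 3) with 3 by (simpl; ring).
    assert (0 <= INR d) by apply pos_INR.
    assert (0 <= INR d * (L - 1)) by (apply Rmult_le_pos; lra).
    assert (0 <= ln A * (L - 1)) by (apply Rmult_le_pos; lra); lra. }
  replace (CJ * Cm * L * (Lam + L)) with (CJ * (Lam + L) * (Cm * L)) by ring.
  apply Rmult_le_compat; auto using pos_INR.
- intros q Hq; apply in_map_iff in Hq; destruct Hq as (x & <- & Hx); cbn [fst snd].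
  destruct (L2 x Hx) as (W1 & W2); split.
  + apply Rmult_lt_0_compat; [exact W1|]; apply Rdiv_lt_0_compat; [apply pow_lt; lra | lra].
  + apply pow_lt; lra.
- intros tau Htau.
  set (f := fun y => y ^ d * exp (- (tau * y) ^ 2)).
  pose (df := fun y => INR d * y ^ pred d * exp (- (tau * y) ^ 2) + y ^ d * (- (2 * tau * tau * y) * exp (- (tau * y) ^ 2))).
  pose (kE := ratio ^ d * exp (- INR p)).
  assert (Df : forall y, is_derive f y (df y)).
  { intro y; unfold f, df; auto_derive; [exact I | simpl; ring]. }
  assert (Hf := derive_continuous f df Df).
  assert (DE : forall y, continuous (fun y => y ^ d * exp (- (tau * y) ^ 2 / 4)) y).
  { intro y; apply (ex_derive_continuous (K := R_AbsRing) (V := R_NormedModule)); auto_derive; exact I. }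
  assert (Hlip : lipschitz_on f Lip a X).
  { apply (lipschitz_of_derive f df); [exact Df|]; intros y Hy; unfold df, Lip.
    assert (E1 : 0 < exp (- (tau * y) ^ 2) <= 1).
    { split; [apply exp_pos|]; rewrite <- exp_0; apply exp_le; assert (0 <= (tau * y) ^ 2) by apply pow2_ge_0; lra. }
    assert (Y1 : 0 <= y ^ pred d <= X ^ pred d) by (split; [apply pow_le; lra | apply pow_incr; lra]).
    assert (Y2 : 0 <= y ^ d <= X ^ d) by (split; [apply pow_le; lra | apply pow_incr; lra]).
    assert (Y3 : 0 <= 2 * tau * tau * y <= 2 * sT * sT * X).
    { split; [repeat apply Rmult_le_pos; lra|].
      apply Rmult_le_compat; try lra; [repeat apply Rmult_le_pos; lra|]. nra. }
    assert (Y4 : 0 <= INR d) by apply pos_INR.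
    apply Rle_trans with (1 := Rabs_triang _ _); apply Rplus_le_compat.
    - rewrite Rabs_right.
      + rewrite <- (Rmult_1_r (INR d * X ^ pred d)); apply Rmult_le_compat; try lra.
        * apply Rmult_le_pos; lra.
        * apply Rmult_le_compat_l; lra.
      + apply Rle_ge; repeat apply Rmult_le_pos; lra.
    - rewrite Ropp_mult_distr_l_reverse, Ropp_mult_distr_r_reverse, Rabs_Ropp, Rabs_right.
      + apply Rmult_le_compat; try lra.
        * apply Rmult_le_pos; lra.
        * rewrite <- (Rmult_1_r (2 * sT * sT * X)); apply Rmult_le_compat; lra.
      + apply Rle_ge; repeat apply Rmult_le_pos; lra. }
  assert (Q := L3 f (fun y => kE * (y ^ d * exp (- (tau * y) ^ 2 / 4))) Hf).
  assert (Q' : Rabs (RInt f a X - qsum f l) <= 2 * (kE * (C2 / tau ^ S d)) + INR J * e).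
  { eapply Rle_trans; [apply Q|].
    - intro x; apply (continuous_scal_r kE (fun y => y ^ d * exp (- (tau * y) ^ 2 / 4))), DE.
    - exact Hlip.
    - intros x Hx; destruct (moment_panel d p tau x ltac:(lra)) as (P & P1 & P2).
      exists P; split; [exact P1 | exact P2].
    - apply Rplus_le_compat_r, Rmult_le_compat_l; [lra|].
      assert (ES : RInt (fun y => kE * (y ^ d * exp (- (tau * y) ^ 2 / 4))) a X
         = kE * RInt (fun y => y ^ d * exp (- (tau * y) ^ 2 / 4)) a X).
      { apply (RInt_scal (V := R_CompleteNormedModule) (fun y => y ^ d * exp (- (tau * y) ^ 2 / 4)) a X kE).
        apply ex_RInt_cont, DE. }
      apply Rle_trans with (1 := Req_le _ _ ES).
      apply Rmult_le_compat_l; [unfold kE; apply Rmult_le_pos; [lra | apply Rlt_le, exp_pos]|].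
      apply Hmom; lra. }
  clear Q.
  rewrite (qsum_map _ (fun y => y ^ d / K) (fun y => y ^ 2)).
  rewrite (qsum_ext _ (fun y => / K * f y)).
  2:{ intros q _; unfold f; replace (- (tau * snd q) ^ 2) with (- snd q ^ 2 * tau ^ 2) by ring; unfold Rdiv; ring. }
  rewrite qsum_scal.
  assert (Htd : 0 < tau ^ S d) by (apply pow_lt; lra).
  assert (Htd' : tau ^ S d <= sT ^ S d) by (apply pow_incr; lra).
  assert (Hc := continuous_moment d).
  assert (Ep : exp (- INR p) <= eta / A).
  { apply Rle_trans with (exp (- ln (A / eta))); [apply exp_le; lra|].
    rewrite exp_Ropp, exp_ln by (apply Rdiv_lt_0_compat; lra); right; field; split; lra. }
  assert (EA : eta / A * (A * kap) = eta * kap) by (field; lra).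
  assert (HeA : 0 < eta / A) by (apply Rdiv_lt_0_compat; lra).
  assert (Ha1 : 0 <= tau * a <= eta / A) by (split; [apply Rmult_le_pos; lra | rewrite <- Eas; nra]).
  assert (Hb1 : A / eta <= tau * X) by nra.
  assert (HeA1 : eta / A <= 1).
  { apply Rmult_le_reg_r with A; [lra|]; replace (eta / A * A) with eta by (field; lra); lra. }
  assert (M1 := moment_head d (tau * a) ltac:(lra)).
  assert (M2 := Htail (tau * X) (sT * X) ltac:(nra)).
  assert (M3 : C1 / (tau * X) <= C1 * (eta / A)).
  { unfold Rdiv at 1; apply Rmult_le_compat_l; [lra|].
    replace (eta / A) with (/ (A / eta)) by (field; split; lra).
    apply Rinv_le_contravar; lra. }
  assert (SK : K = RInt (fun v => v ^ d * exp (- v ^ 2)) 0 (tau * a)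
     + tau ^ S d * RInt f a X + RInt (fun v => v ^ d * exp (- v ^ 2)) (tau * X) (sT * X)).
  { unfold f; rewrite moment_scale by lra; unfold K.
    rewrite <- (RInt_Chasles _ 0 (tau * X)) by now apply ex_RInt_cont.
    rewrite <- (RInt_Chasles _ 0 (tau * a) (tau * X)) by now apply ex_RInt_cont.
    reflexivity. }
  set (I1 := RInt (fun v => v ^ d * exp (- v ^ 2)) 0 (tau * a)) in *.
  set (I3 := RInt (fun v => v ^ d * exp (- v ^ 2)) (tau * X) (sT * X)) in *.
  set (Qf := qsum f l) in *.
  assert (R1 : tau ^ S d * (2 * (kE * (C2 / tau ^ S d)) + INR J * e)
      <= 2 * ratio ^ d * C2 * (eta / A) + kap * eta / 4).
  { rewrite Rmult_plus_distr_l; apply Rplus_le_compat.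
    - replace (tau ^ S d * (2 * (kE * (C2 / tau ^ S d)))) with (2 * ratio ^ d * C2 * exp (- INR p))
        by (unfold kE; field; lra).
      apply Rmult_le_compat_l; [nra | exact Ep].
    - apply Rle_trans with (sT ^ S d * ((INR J + 1) * e)).
      + apply Rmult_le_compat; try lra; apply Rmult_le_pos; lra.
      + right; unfold e; field; split; lra. }
  assert (R2 : Rabs (tau ^ S d * (RInt f a X - Qf)) <= 2 * ratio ^ d * C2 * (eta / A) + kap * eta / 4).
  { rewrite Rabs_mult, Rabs_right by lra.
    eapply Rle_trans; [apply Rmult_le_compat_l; [lra | exact Q']|exact R1]. }
  assert (R3 : Rabs (K - tau ^ S d * Qf) <= kap * eta).
  { replace (K - tau ^ S d * Qf) with (I1 + I3 + tau ^ S d * (RInt f a X - Qf) + 0) by (rewrite SK; ring).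
    eapply Rle_trans; [apply (Rabs_4 _ _ _ _ (eta / A) (C1 * (eta / A)) (2 * ratio ^ d * C2 * (eta / A) + kap * eta / 4) 0); [| |exact R2|]|].
    - rewrite Rabs_right by lra; lra.
    - rewrite Rabs_right by lra; lra.
    - rewrite Rabs_R0; lra.
    - rewrite HA in EA; assert (0 <= kap * eta) by (apply Rmult_le_pos; lra); lra. }
  replace (tau ^ S d * (/ K * Qf) - 1) with (- (/ K * (K - tau ^ S d * Qf))) by (field; lra).
  rewrite Rabs_Ropp, Rabs_mult, Rabs_right by (apply Rle_ge, Rlt_le, Rinv_0_lt_compat; lra).
  apply Rmult_le_reg_l with K; [lra|].
  rewrite <- Rmult_assoc, Rinv_r, Rmult_1_l by lra.
  apply Rle_trans with (1 := R3), Rmult_le_compat_r; lra.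
Qed.

(** * The Gaussian as a contour sum *)

(** Real and imaginary parts of z^2 t - z r at z = x + 2i (x - c). *)
Definition phase_re (c t r x : R) : R := t * (x ^ 2 - 4 * (x - c) ^ 2) - x * r.
Definition phase_im (c t r x : R) : R := 4 * t * x * (x - c) - 2 * (x - c) * r.

(* The imaginary part of (1 + 2i) exp (z^2 t - z r) at z = x + 2i (x - c). *)
Definition contour_integrand (c t r x : R) : R :=
  exp (phase_re c t r x) * (sin (phase_im c t r x) + 2 * cos (phase_im c t r x)).

(** The phase varies on a panel by at most 0.1608 t x^2 + 0.03 x r, the 0.01 being the relative
    width of a panel. Tripled, the part in r is absorbed by the decay e^{-x r}, so the bound does
    not involve r; the part in t is absorbed by the Gaussian decay along the ray, up to the growth
    e^{4 c^2 t} allowed for the corner. The leading 3 bounds |1 + 2i|. *)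
Lemma contour_panel c p tau r x : 0 < c <= x -> 0 <= r -> exists P, polyn (3 * p + 5) P /\
  forall y y', x <= y <= ratio * x -> x <= y' <= ratio * x ->
  Rabs (contour_integrand c (tau ^ 2) r y - P y)
    <= 3 * exp (- INR p + 4 * c ^ 2 * tau ^ 2) * (y' ^ 0 * exp (- (tau * y') ^ 2 / 4)).
Proof.
intros Hx Hr; set (t := tau ^ 2).
assert (Ht : 0 <= t) by apply pow2_ge_0.
pose (u := fun y => (phase_re c t r y - phase_re c t r x, phase_im c t r y - phase_im c t r x) : Cx).
pose (A := Cmul (1, 2) (Cexp (phase_re c t r x, phase_im c t r x))).
exists (fun y => snd (Cmul A (Ctaylor p 1 (u y)))); split.
- assert (Hu : cpolyn 3 u).
  { unfold u, phase_re, phase_im; split; cbn [fst snd].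
    - apply polyn_ext with (fun y => (- 4 * t * c ^ 2 - (t * (x ^ 2 - 4 * (x - c) ^ 2) - x * r))
         + (8 * t * c - r) * y + (- 3 * t) * y ^ 2); [intro; ring | apply polyn_quad].
    - apply polyn_ext with (fun y => (2 * c * r - (4 * t * x * (x - c) - 2 * (x - c) * r))
         + (- 4 * t * c - 2 * r) * y + (4 * t) * y ^ 2); [intro; ring | apply polyn_quad]. }
  apply polyn_le with (1 + (3 * p + 2))%nat; [lia|].
  exact (proj2 (cpolyn_mul 1 (3 * p + 2) (fun _ => A) _ (cpolyn_const A) (cpolyn_Ctaylor 3 u p 1 Hu))).
- intros y y' Hy Hy'; unfold ratio in Hy, Hy'.
  assert (E1 : contour_integrand c t r y = snd (Cmul A (Cexp (u y)))).
  { unfold contour_integrand, A, u, Cmul, Cexp; cbn [fst snd].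
    set (p0 := phase_re c t r x); set (q0 := phase_im c t r x).
    set (p1 := phase_re c t r y); set (q1 := phase_im c t r y).
    replace p1 with (p0 + (p1 - p0)) at 1 by ring.
    replace q1 with (q0 + (q1 - q0)) at 1 2 by ring.
    rewrite exp_plus, sin_plus, cos_plus; ring. }
  rewrite E1.
  replace (snd (Cmul A (Cexp (u y))) - snd (Cmul A (Ctaylor p 1 (u y))))
    with (snd (Cmul A (Csub (Cexp (u y)) (Ctaylor p 1 (u y)))))
    by (unfold Cmul, Csub; cbn [fst snd]; ring).
  apply Rle_trans with (1 := Rabs_snd_le_Cmod _).
  rewrite Cmod_mul; unfold A; rewrite Cmod_mul, Cmod_Cexp; cbn [fst snd].
  assert (H12 : Cmod (1, 2) <= 3).
  { apply Rle_trans with (1 := Cmod_le_sum _); cbn [fst snd]; rewrite !Rabs_right; lra. }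
  assert (H2 := exp_Taylor_remainder1 (u y) p).
  assert (H3 : Cmod (u y) <= 0.1608 * (t * x ^ 2) + 0.03 * (x * r)).
  { apply Rle_trans with (1 := Cmod_le_sum _); unfold u; cbn [fst snd].
    replace (phase_re c t r y - phase_re c t r x)
      with ((y - x) * (t * (8 * c - 3 * (y + x)) - r)) by (unfold phase_re; ring).
    replace (phase_im c t r y - phase_im c t r x)
      with ((y - x) * (t * (4 * (y + x) - 4 * c) - 2 * r)) by (unfold phase_im; ring).
    rewrite !Rabs_mult, (Rabs_right (y - x)) by lra.
    assert (B1 : Rabs (t * (8 * c - 3 * (y + x)) - r) <= t * (8.04 * x) + r).
    { assert (t * (8 * c - 3 * (y + x)) <= t * (8.04 * x)) by (apply Rmult_le_compat_l; lra).
      assert (t * (- (8.04 * x)) <= t * (8 * c - 3 * (y + x))) by (apply Rmult_le_compat_l; lra).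
      apply Rabs_le; lra. }
    assert (B2 : Rabs (t * (4 * (y + x) - 4 * c) - 2 * r) <= t * (8.04 * x) + 2 * r).
    { assert (t * (4 * (y + x) - 4 * c) <= t * (8.04 * x)) by (apply Rmult_le_compat_l; lra).
      assert (t * 0 <= t * (4 * (y + x) - 4 * c)) by (apply Rmult_le_compat_l; lra).
      assert (0 <= t * (8.04 * x)) by (apply Rmult_le_pos; lra).
      apply Rabs_le; lra. }
    apply Rle_trans with ((0.01 * x) * (t * (16.08 * x) + 3 * r)); [|lra].
    assert (0 <= t * (16.08 * x)) by (apply Rmult_le_pos; lra).
    rewrite <- Rmult_plus_distr_l; apply Rmult_le_compat; try lra.
    apply Rplus_le_le_0_compat; apply Rabs_pos. }
  assert (Hxr : 0 <= x * r) by (apply Rmult_le_pos; lra).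
  assert (Htx : 0 <= t * x ^ 2) by (apply Rmult_le_pos; [lra | apply pow2_ge_0]).
  assert (H4 : exp 1 * Cmod (u y) <= 0.4824 * (t * x ^ 2) + 0.09 * (x * r)).
  { assert (H := exp_le_3); assert (H' := Cmod_nonneg (u y)).
    apply Rle_trans with (3 * Cmod (u y)); [apply Rmult_le_compat_r; lra | lra]. }
  assert (H5 : exp (phase_re c t r x) * exp (- INR p + exp 1 * Cmod (u y))
     <= exp (- INR p + 4 * c ^ 2 * t) * exp (- (tau * y') ^ 2 / 4)).
  { rewrite <- !exp_plus; apply exp_le; unfold phase_re.
    assert (Hq : y' ^ 2 <= 1.0201 * x ^ 2) by nra.
    replace ((tau * y') ^ 2) with (t * y' ^ 2) by (unfold t; ring).
    assert (t * y' ^ 2 <= t * (1.0201 * x ^ 2)) by (apply Rmult_le_compat_l; assumption).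
    (* This square gives 8 x c <= 2 x^2 + 8 c^2, hence Re z^2 <= 4 c^2 - x^2 on the ray. *)
    assert (0 <= t * (2 * (x - 2 * c) ^ 2)).
    { apply Rmult_le_pos; [lra|]; assert (0 <= (x - 2 * c) ^ 2) by apply pow2_ge_0; lra. }
    replace (t * (2 * (x - 2 * c) ^ 2)) with (2 * (t * x ^ 2) - 8 * (t * x * c) + 8 * (t * c ^ 2)) in * by ring.
    replace (t * (x ^ 2 - 4 * (x - c) ^ 2)) with (- 3 * (t * x ^ 2) + 8 * (t * x * c) - 4 * (t * c ^ 2)) by ring.
    lra. }
  apply Rle_trans with (3 * (exp (phase_re c t r x) * exp (- INR p + exp 1 * Cmod (u y)))).
  + rewrite Rmult_assoc.
    assert (E0 := exp_pos (phase_re c t r x)).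
    apply Rmult_le_compat; try exact H12; try apply Cmod_nonneg.
    * apply Rmult_le_pos; [lra | apply Cmod_nonneg].
    * apply Rmult_le_compat_l; lra.
  + simpl (y' ^ 0); lra.
Qed.

Definition erf_path (k b : R) : R :=
  RInt (fun y => exp (- y ^ 2)) 0 b
  + RInt (fun s => exp (s ^ 2 - b ^ 2) * sin (2 * s * b)) 0 (b / 2 + k).

Lemma continuous_gauss x : continuous (fun y => exp (- y ^ 2)) x.
Proof. apply (ex_derive_continuous (K := R_AbsRing) (V := R_NormedModule)); auto_derive; exact I. Qed.

Lemma continuous_erf_rem b x : continuous (fun s => exp (s ^ 2 - b ^ 2) * sin (2 * s * b)) x.
Proof. apply (ex_derive_continuous (K := R_AbsRing) (V := R_NormedModule)); auto_derive; exact I. Qed.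

(* [erf_path k b] is the imaginary part of the primitive of exp (w^2) vanishing at 0, taken at
   w = (b / 2 + k) + i b along the path 0, i b, w. *)
Lemma is_derive_erf_path k b :
  is_derive (erf_path k) b
    (exp ((b / 2 + k) ^ 2 - b ^ 2) * (cos (2 * (b / 2 + k) * b) + / 2 * sin (2 * (b / 2 + k) * b))).
Proof.
set (f := fun x s => exp (s ^ 2 - x ^ 2) * sin (2 * s * x)).
set (df := fun x s => exp (s ^ 2 - x ^ 2) * (2 * s * cos (2 * s * x) - 2 * x * sin (2 * s * x))).
assert (Df : forall x s, is_derive (fun z => f z s) x (df x s)).
{ intros x s; unfold f, df; auto_derive; [exact I | simpl; unfold Rminus; ring]. }
assert (cont_df : forall x s, continuity_2d_pt (fun u v => Derive (fun z => f z v) u) x s).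
{ intros x s; apply continuity_2d_pt_ext with df.
  { intros u v; symmetry; apply is_derive_unique, Df. }
  assert (sin2 : continuity_2d_pt (fun u v => sin (2 * v * u)) x s).
  { apply (continuity_1d_2d_pt_comp sin (fun u v => 2 * v * u)); [apply continuity_sin|].
    repeat first [apply continuity_2d_pt_mult | apply continuity_2d_pt_const | apply continuity_2d_pt_id1 | apply continuity_2d_pt_id2]. }
  assert (cos2 : continuity_2d_pt (fun u v => cos (2 * v * u)) x s).
  { apply (continuity_1d_2d_pt_comp cos (fun u v => 2 * v * u)); [apply continuity_cos|].
    repeat first [apply continuity_2d_pt_mult | apply continuity_2d_pt_const | apply continuity_2d_pt_id1 | apply continuity_2d_pt_id2]. }
  assert (exp2 : continuity_2d_pt (fun u v => exp (v ^ 2 - u ^ 2)) x s).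
  { apply (continuity_1d_2d_pt_comp exp (fun u v => v ^ 2 - u ^ 2)).
    - apply derivable_continuous_pt, derivable_pt_exp.
    - apply continuity_2d_pt_minus; simpl;
      repeat first [apply continuity_2d_pt_mult | apply continuity_2d_pt_const | apply continuity_2d_pt_id1 | apply continuity_2d_pt_id2]. }
  apply continuity_2d_pt_mult; [exact exp2|].
  apply continuity_2d_pt_minus; apply continuity_2d_pt_mult; try assumption;
    repeat first [apply continuity_2d_pt_mult | apply continuity_2d_pt_const | apply continuity_2d_pt_id1 | apply continuity_2d_pt_id2]. }
assert (ex_f : forall x u v, ex_RInt (fun s => f x s) u v).
{ intros; apply ex_RInt_cont; intro; apply continuous_erf_rem. }
unfold erf_path; evar_last.
- apply @is_derive_plus.
  + apply (is_derive_RInt (fun y => exp (- y ^ 2)) (RInt (fun y => exp (- y ^ 2)) 0) 0).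
    * apply filter_forall; intro y; apply (RInt_correct (V := R_CompleteNormedModule)), ex_RInt_cont, continuous_gauss.
    * apply continuous_gauss.
  + apply (is_derive_RInt_param_bound_comp f (fun _ => 0) (fun x => x / 2 + k) b 0 (/ 2)).
    * apply filter_forall; intro y; apply ex_f.
    * exists (mkposreal 1 Rlt_0_1); apply filter_forall; intro y; apply ex_f.
    * exists (mkposreal 1 Rlt_0_1); apply filter_forall; intro y; apply ex_f.
    * apply @is_derive_const.
    * auto_derive; [exact I | field].
    * exists (mkposreal 1 Rlt_0_1); apply filter_forall; intros y s _; eexists; apply Df.
    * intros; apply cont_df.
    * apply locally_2d_forall; intros; apply cont_df.
    * apply locally_2d_forall; intros; apply cont_df.
    * apply continuity_pt_filterlim, continuous_erf_rem.
    * apply continuity_pt_filterlim, continuous_erf_rem.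
- rewrite (RInt_ext _ (df b)) by (intros; apply is_derive_unique, Df).
  (* Cauchy-Riemann for e^{(s + i b)^2}: the b-derivative of its imaginary part is the s-derivative
     of its real part. The value at s = 0 cancels the e^{-b^2} from the vertical segment. *)
  rewrite (RInt_FTC (fun s => exp (s ^ 2 - b ^ 2) * cos (2 * s * b))).
  + as_R_eq; unfold plus; simpl; unfold f.
    replace (2 * 0 * b) with 0 by ring; rewrite cos_0.
    replace (0 * (0 * 1) - b * (b * 1)) with (- (b * (b * 1))) by ring.
    simpl; field.
  + intro s; unfold df; auto_derive; [exact I | simpl; unfold Rminus; ring].
  + intro s; apply (ex_derive_continuous (K := R_AbsRing) (V := R_NormedModule)); unfold df; auto_derive; exact I.
Qed.

(** Completing the square, with w = tau z - r/(2 tau), extracts the Gaussian. The ray becomes a path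
    of points (b/2 + k) + i b that starts on the real axis, where [erf_path] is 0. *)
Lemma contour_integral c tau r X : 0 < tau ->
  tau * RInt (contour_integrand c (tau ^ 2) r) c X
  = exp (- r ^ 2 / (4 * tau ^ 2)) * erf_path (tau * c - r / (2 * tau)) (2 * tau * (X - c)).
Proof.
intro Ht; set (k := tau * c - r / (2 * tau)).
assert (cont : forall x, continuous (contour_integrand c (tau ^ 2) r) x).
{ intro x; unfold contour_integrand, phase_re, phase_im.
  apply (ex_derive_continuous (K := R_AbsRing) (V := R_NormedModule)); auto_derive; exact I. }
assert (D : forall x, is_derive (fun x => / tau * (exp (- r ^ 2 / (4 * tau ^ 2)) * erf_path k (2 * tau * (x - c)))) x
   (contour_integrand c (tau ^ 2) r x)).
{ intro x; evar_last.
  - apply is_derive_scal, is_derive_scal.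
    apply (is_derive_comp (erf_path k) (fun x => 2 * tau * (x - c))); [apply is_derive_erf_path|].
    auto_derive; [exact I | reflexivity].
  - as_R_eq; unfold scal; simpl; unfold mult; simpl.
    unfold contour_integrand.
    set (w := 2 * tau * (x - c)).
    replace (2 * (w / 2 + k) * w) with (phase_im c (tau ^ 2) r x)
      by (unfold phase_im, w, k; field; lra).
    replace ((w / 2 + k) * ((w / 2 + k) * 1) - w * (w * 1)) with (phase_re c (tau ^ 2) r x + r ^ 2 / (4 * tau ^ 2))
      by (unfold phase_re, w, k; field; lra).
    rewrite exp_plus.
    assert (E : exp (r ^ 2 / (4 * tau ^ 2)) * exp (- r ^ 2 / (4 * tau ^ 2)) = 1).
    { rewrite <- exp_plus, <- exp_0; f_equal; field; lra. }
    simpl in E |- *.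
    set (e1 := exp (r * (r * 1) / (4 * (tau * (tau * 1))))) in *.
    set (e2 := exp (- (r * (r * 1)) / (4 * (tau * (tau * 1))))) in *.
    set (P := exp _); set (SN := sin _); set (CS := cos _).
    transitivity ((e1 * e2) * (P * (SN + 2 * CS))); [|rewrite E; ring].
    field; lra. }
rewrite (RInt_FTC _ _ c X D cont).
assert (E0 : erf_path k (2 * tau * (c - c)) = 0).
{ replace (2 * tau * (c - c)) with 0 by ring; unfold erf_path.
  rewrite RInt_point; unfold zero; simpl.
  rewrite (RInt_ext _ (fun _ => 0)) by (intros; rewrite Rmult_0_r, sin_0; as_R_eq; ring).
  rewrite RInt_const; unfold scal; simpl; unfold mult; simpl; ring. }
rewrite E0; field; lra.
Qed.

(** Stated for both signs of [a]: the horizontal segment runs to the left when r is large compared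
    with tau^2 X. *)
Lemma erf_rem_le a b :
  Rabs (RInt (fun s => exp (s ^ 2 - b ^ 2) * sin (2 * s * b)) 0 a) <= Rabs a * exp (a ^ 2 - b ^ 2).
Proof.
assert (C := continuous_erf_rem b).
assert (Hb : forall s, Rabs s <= Rabs a -> Rabs (exp (s ^ 2 - b ^ 2) * sin (2 * s * b)) <= exp (a ^ 2 - b ^ 2)).
{ intros s Hs; assert (E0 := exp_pos (s ^ 2 - b ^ 2)).
  rewrite Rabs_mult, (Rabs_right (exp _)) by lra.
  apply Rle_trans with (exp (s ^ 2 - b ^ 2) * 1).
  - apply Rmult_le_compat_l; [lra|]; assert (H := SIN_bound (2 * s * b)); apply Rabs_le; lra.
  - rewrite Rmult_1_r; apply exp_le.
    rewrite <- (pow2_abs s), <- (pow2_abs a); assert (H := Rabs_pos s); nra. }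
destruct (Rle_lt_dec 0 a) as [Ha|Ha].
- rewrite (Rabs_right a) by lra; replace a with (a - 0) at 2 by ring.
  apply abs_RInt_le_const; [exact Ha | now apply ex_RInt_cont |].
  intros s Hs; apply Hb; rewrite !Rabs_right; lra.
- rewrite <- (opp_RInt_swap (V := R_CompleteNormedModule)) by now apply ex_RInt_cont.
  unfold opp; simpl; rewrite Rabs_Ropp.
  rewrite (Rabs_left a) by lra; replace (- a) with (0 - a) by ring.
  replace (a * (a * 1)) with (a ^ 2) by (simpl; ring).
  apply (abs_RInt_le_const (fun s => exp (s ^ 2 - b ^ 2) * sin (2 * s * b)));
    [lra | now apply ex_RInt_cont |].
  intros s Hs; apply Hb; rewrite !Rabs_left1; lra.
Qed.

(** The deviation is the horizontal part of [erf_path], of length |a| with a = V - m/(2V), V = tau X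
    and m = X r. The Gaussian prefactor cancels r^2/(4t) in a^2 and leaves the exponent V^2 - m -
    b^2. Now |a| <= e^{V^2/4 + m}, and X >= 4c gives b >= 3V/2, so everything adds up to at most
    -V^2, without r. *)
Lemma contour_value c tau r X : 0 < c -> 4 * c <= X -> 0 < tau -> 1 <= tau * X -> 0 <= r ->
  Rabs (tau * RInt (contour_integrand c (tau ^ 2) r) c X
     - exp (- r ^ 2 / (4 * tau ^ 2)) * RInt (fun y => exp (- y ^ 2)) 0 (2 * tau * (X - c)))
  <= exp (- (tau * X) ^ 2).
Proof.
intros Hc HX Ht HV Hr; rewrite contour_integral by exact Ht.
unfold erf_path.
set (b := 2 * tau * (X - c)).
replace (b / 2 + (tau * c - r / (2 * tau))) with (tau * X - r / (2 * tau)) by (unfold b; field; lra).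
set (a := tau * X - r / (2 * tau)).
rewrite Rmult_plus_distr_l.
match goal with |- Rabs (?A + ?B - ?A) <= _ => replace (A + B - A) with B by ring end.
rewrite Rabs_mult, (Rabs_right (exp _)) by (apply Rle_ge, Rlt_le, exp_pos).
apply Rle_trans with (exp (- r ^ 2 / (4 * tau ^ 2)) * (Rabs a * exp (a ^ 2 - b ^ 2))).
{ apply Rmult_le_compat_l; [apply Rlt_le, exp_pos | apply erf_rem_le]. }
set (V := tau * X) in *; set (m := X * r).
assert (Hm : 0 <= m) by (apply Rmult_le_pos; lra).
assert (Em : r / (2 * tau) = m / (2 * V)) by (unfold m, V; field; split; lra).
assert (Hm2 : 0 <= m / (2 * V) <= m).
{ split; [apply Rdiv_le_0_compat; lra|].
  apply Rmult_le_reg_r with (2 * V); [lra|]; replace (m / (2 * V) * (2 * V)) with m by (field; lra); nra. }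
assert (Ha : Rabs a <= exp (V ^ 2 / 4) * exp m).
{ assert (H1 : 1 + V ^ 2 / 4 <= exp (V ^ 2 / 4)) by apply exp_ineq1_le.
  assert (H2 : 1 + m <= exp m) by apply exp_ineq1_le.
  assert (H3 : V <= 1 + V ^ 2 / 4) by (assert (0 <= (V - 2) ^ 2) by apply pow2_ge_0; nra).
  apply Rle_trans with (V * (1 + m)).
  - unfold a; rewrite Em; apply Rabs_le; nra.
  - apply Rmult_le_compat; lra. }
apply Rle_trans with (exp (- r ^ 2 / (4 * tau ^ 2)) * (exp (V ^ 2 / 4) * exp m * exp (a ^ 2 - b ^ 2))).
{ apply Rmult_le_compat_l; [apply Rlt_le, exp_pos|].
  apply Rmult_le_compat_r; [apply Rlt_le, exp_pos | exact Ha]. }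
rewrite <- !exp_plus; apply exp_le.
assert (Ea : a ^ 2 = V ^ 2 - m + r ^ 2 / (4 * tau ^ 2)) by (unfold a, V, m; field; lra).
assert (Hb : 9 / 4 * V ^ 2 <= b ^ 2).
{ assert (0 <= 3 / 2 * V <= b); [|nra].
  unfold b, V; split; [unfold V in HV; lra|].
  replace (2 * tau * (X - c)) with (tau * (2 * (X - c))) by ring.
  replace (3 / 2 * (tau * X)) with (tau * (3 / 2 * X)) by ring.
  apply Rmult_le_compat_l; lra. }
assert (Er : - r ^ 2 / (4 * tau ^ 2) = - (r ^ 2 / (4 * tau ^ 2))) by (field; lra).
rewrite Ea, Er; lra.
Qed.

Lemma gauss_tail b B : 1 <= b <= B ->
  0 <= RInt (fun y => exp (- y ^ 2)) b B <= exp (- b ^ 2).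
Proof.
intro H; assert (C := continuous_gauss); split.
- apply RInt_ge_0; [lra | now apply ex_RInt_cont | intros; apply Rlt_le, exp_pos].
- assert (C' : forall x, continuous (fun y => 2 * y * exp (- y ^ 2)) x).
  { intro x; apply (ex_derive_continuous (K := R_AbsRing) (V := R_NormedModule)); auto_derive; exact I. }
  apply Rle_trans with (RInt (fun y => 2 * y * exp (- y ^ 2)) b B).
  + apply RInt_le; [lra | now apply ex_RInt_cont | now apply ex_RInt_cont |].
    intros y Hy; assert (0 < exp (- y ^ 2)) by apply exp_pos; nra.
  + rewrite (RInt_FTC (fun y => - exp (- y ^ 2))); [|intro x; auto_derive; [exact I | simpl; ring] | exact C'].
    assert (0 < exp (- B ^ 2)) by apply exp_pos; lra.
Qed.

Lemma Rabs_3 a b c A B C :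
  Rabs a <= A -> Rabs b <= B -> Rabs c <= C -> Rabs (a + b + c) <= A + B + C.
Proof.
intros; assert (T1 := Rabs_triang (a + b) c); assert (T2 := Rabs_triang a b); lra.
Qed.

(** The bound [r0] enters only the Lipschitz constant, hence not the number of nodes. *)
Lemma gaussian_exponential_sum : exists C, 0 < C /\
  forall eta delta T r0, 0 < eta < 1 / 10 -> 0 < delta -> 1000 * delta <= T -> 0 <= r0 ->
  exists c l, 0 < c /\ INR (length l) <= C * ln (T / delta) * ln (1 / eta) /\
    (forall p, In p l -> c < snd p) /\
    forall tau r, sqrt delta <= tau <= sqrt T -> 0 <= r <= r0 ->
      Rabs (tau * qsum (contour_integrand c (tau ^ 2) r) l - exp (- r ^ 2 / (4 * tau ^ 2))) <= eta.
Proof.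
destruct (gauss_moment_le 0) as (C2 & HC2 & Hmom).
(* Makes the contour, tail and Taylor errors (2 + 6 C2) eta / A equal to eta / 6; with eta / 12 for
   the Riemann sums this stays below eta / 3 <= K eta. *)
set (A := 6 * (2 + 6 * C2)).
assert (HA1 : 18 <= A) by (unfold A; lra).
assert (HlA : 1 <= ln A) by (apply ln_ge_1; lra).
assert (Hlq := ln_ratio_pos).
set (CJ := / 2 / ln ratio + 1).
set (Cm := 15 * ln A + 23).
assert (HCJ : 0 < CJ).
{ unfold CJ; assert (0 < / 2 / ln ratio) by (apply Rdiv_lt_0_compat; lra); lra. }
assert (HCm : 0 < Cm) by (unfold Cm; lra).
exists (CJ * Cm); split; [now apply Rmult_lt_0_compat|].
intros eta delta T r0 Heta Hdelta HT Hr0.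
set (sd := sqrt delta); set (sT := sqrt T).
assert (Hsd : 0 < sd) by (apply sqrt_lt_R0; lra).
assert (HsT : 0 < sT) by (apply sqrt_lt_R0; lra).
assert (Esd : delta = sd * sd) by (symmetry; apply sqrt_sqrt; lra).
assert (EsT : T = sT * sT) by (symmetry; apply sqrt_sqrt; lra).
(* From T >= 1000 delta; it yields X >= 4c, which [contour_value] requires. *)
assert (HsdT : 4 * sd <= sT).
{ apply Rsqr_incr_0; unfold Rsqr; lra. }
clearbody sd sT.
set (L := ln (1 / eta)); set (Lam := ln (T / delta)).
assert (HL : 1 <= L).
{ apply ln_ge_1; apply Rmult_lt_reg_r with eta; [lra|].
  replace (1 / eta * eta) with 1 by (field; lra); lra. }
assert (HLam : 1 <= Lam).
{ apply ln_ge_1; apply Rmult_lt_reg_r with delta; [lra|].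
  replace (T / delta * delta) with T by (field; lra); lra. }
set (rho := sT / sd).
assert (Hrho : 4 <= rho).
{ apply Rmult_le_reg_r with sd; [lra|]; unfold rho; replace (sT / sd * sd) with sT by (field; lra); lra. }
assert (ElnA : ln (A / eta) = ln A + L).
{ unfold L; rewrite <- ln_mult; [f_equal; field; lra | lra | apply Rdiv_lt_0_compat; lra]. }
assert (Elnrho : ln rho = Lam / 2).
{ unfold Lam, rho; rewrite Esd, EsT; replace (sT * sT / (sd * sd)) with ((sT / sd) * (sT / sd)) by (field; lra).
  rewrite ln_mult by (fold rho; lra); lra. }
set (ell := ln A + L) in *.
assert (Hell : 1 <= ell) by (unfold ell; lra).
destruct (panel_count rho ltac:(lra)) as (J & HJ1 & HJ2).
(* Four of the five [ell] pay for the growth 4 c^2 t <= 4 c^2 T = 4 ell at the corner, and the fifth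
   leaves e^{-ell} = eta / A. *)
destruct (nat_above (5 * ell)) as (p & Hp1 & Hp2); [lra|].
set (c := sqrt ell / sT).
assert (Hse : 0 < sqrt ell) by (apply sqrt_lt_R0; lra).
assert (Hse2 : sqrt ell * sqrt ell = ell) by (apply sqrt_sqrt; lra).
assert (Hse1 : 1 <= sqrt ell) by nra.
assert (Hc : 0 < c) by (apply Rdiv_lt_0_compat; lra).
assert (EcT : c * sT = sqrt ell) by (unfold c; field; lra).
clearbody c.
set (X := c * ratio ^ J).
assert (EX : X = c * ratio ^ J) by reflexivity.
assert (HX4 : 4 * c <= X) by (unfold X; nra).
assert (HX : sqrt ell <= sd * X).
{ rewrite <- EcT; apply Rle_trans with (sd * (c * rho)).
  - right; unfold rho; field; lra.
  - apply Rmult_le_compat_l; [lra|]; apply Rmult_le_compat_l; lra. }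
clearbody X.
assert (HJ0 : 0 <= INR J) by apply pos_INR.
set (m := (3 * p + 5)%nat).
set (t1 := sT * sT).
(* Bounds for the x-derivatives of the real and imaginary phase, valid for all t <= T and r <= r0;
   the factors 3 in [Lip] bound the trigonometric parts. *)
pose (D1 := t1 * (9 * X) + r0); pose (D2 := t1 * (9 * X) + 3 * r0).
pose (Lip := exp (t1 * X ^ 2) * (D1 * 3 + 3 * D2)).
assert (Ht1 : 0 < t1) by (apply Rmult_lt_0_compat; lra).
assert (HtX : 0 < t1 * (9 * X)) by (apply Rmult_lt_0_compat; lra).
assert (HLip : 0 <= Lip).
{ apply Rmult_le_pos; [apply Rlt_le, exp_pos | unfold D1, D2; lra]. }
set (e := eta / (12 * sT * (INR J + 1))).
assert (He : 0 < e).
{ apply Rdiv_lt_0_compat; [lra|]; apply Rmult_lt_0_compat; lra. }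
destruct (geometric_rule c ratio m Lip e J Hc ltac:(unfold ratio; lra) ltac:(unfold m; lia) He HLip)
  as (l & L1 & L2 & L3).
rewrite <- EX in L2, L3.
set (B := 2 * sT * (X - c)).
assert (HsX : sqrt ell <= sT * X) by (assert (sd * X <= sT * X) by (apply Rmult_le_compat_r; lra); lra).
assert (HB : 1 <= B).
{ unfold B; apply Rle_trans with (sT * X); [lra|].
  replace (2 * sT * (X - c)) with (sT * (2 * (X - c))) by ring; apply Rmult_le_compat_l; lra. }
(* Again the value at the largest tau; for smaller tau the integral stops at b <= B, and the
   Gaussian tail beyond b >= tau X >= sqrt ell is at most eta / A. *)
set (K := RInt (fun y => exp (- y ^ 2)) 0 B).
assert (HK : / 3 <= K).
{ assert (H := moment_low 0 B HB); unfold K.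
  rewrite (RInt_ext _ (fun v => exp (- v ^ 2))) in H by (intros; as_R_eq; simpl; ring).
  simpl INR in H; lra. }
exists c, (map (fun q => (fst q * / K, snd q)) l).
split; [exact Hc|]; split; [|split].
- rewrite length_map.
  apply Rle_trans with (INR (J * m)); [now apply le_INR|].
  rewrite mult_INR.
  assert (B1 : INR J <= CJ * Lam).
  { apply Rle_trans with (1 := HJ2); rewrite Elnrho; unfold CJ.
    rewrite Rmult_plus_distr_r; apply Rplus_le_compat; [right; field|]; lra. }
  assert (B2 : INR m <= Cm * L).
  { unfold m, Cm; rewrite !plus_INR, mult_INR; replace (INR 3) with 3 by (simpl; ring).
    replace (INR 5) with 5 by (simpl; ring); unfold ell in Hp2.
    assert (0 <= ln A * (L - 1)) by (apply Rmult_le_pos; lra); lra. }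
  replace (CJ * Cm * Lam * L) with (CJ * Lam * (Cm * L)) by ring.
  apply Rmult_le_compat; auto using pos_INR.
- intros q Hq; apply in_map_iff in Hq; destruct Hq as (x & <- & Hx); cbn [fst snd].
  now apply L2.
- intros tau r Htau Hr.
  set (f := contour_integrand c (tau ^ 2) r).
  pose (df := fun x => exp (phase_re c (tau ^ 2) r x) *
     ((tau ^ 2 * (8 * c - 6 * x) - r) * (sin (phase_im c (tau ^ 2) r x) + 2 * cos (phase_im c (tau ^ 2) r x))
      + (cos (phase_im c (tau ^ 2) r x) - 2 * sin (phase_im c (tau ^ 2) r x)) * (tau ^ 2 * (8 * x - 4 * c) - 2 * r))).
  assert (Df : forall y, is_derive f y (df y)).
  { intro y; unfold f, df, contour_integrand, phase_re, phase_im; auto_derive; [exact I | simpl; unfold Rminus; ring]. }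
  assert (Hf := derive_continuous f df Df).
  assert (Ht2 : 0 <= tau ^ 2 <= t1) by (unfold t1; nra).
  pose (kE := 3 * exp (- INR p + 4 * c ^ 2 * tau ^ 2)).
  assert (DE : forall y, continuous (fun y => y ^ 0 * exp (- (tau * y) ^ 2 / 4)) y).
  { intro y; apply (ex_derive_continuous (K := R_AbsRing) (V := R_NormedModule)); auto_derive; exact I. }
  assert (Hlip : lipschitz_on f Lip c X).
  { apply (lipschitz_of_derive f df); [exact Df|]; intros y Hy; unfold df, Lip.
    set (s := phase_im c (tau ^ 2) r y).
    assert (Hs := SIN_bound s); assert (Hcs := COS_bound s).
    assert (X1 : exp (phase_re c (tau ^ 2) r y) <= exp (t1 * X ^ 2)).
    { apply exp_le; unfold phase_re.
      assert (0 <= y * r) by (apply Rmult_le_pos; lra).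
      assert (tau ^ 2 * (y ^ 2 - 4 * (y - c) ^ 2) <= tau ^ 2 * X ^ 2).
      { apply Rmult_le_compat_l; [lra|]; assert (0 <= (y - c) ^ 2) by apply pow2_ge_0; nra. }
      assert (tau ^ 2 * X ^ 2 <= t1 * X ^ 2) by (apply Rmult_le_compat_r; [apply pow2_ge_0 | lra]).
      lra. }
    assert (X2 : forall u, - (9 * X) <= u <= 9 * X -> - (t1 * (9 * X)) <= tau ^ 2 * u <= t1 * (9 * X)).
    { intros u Hu.
      assert (tau ^ 2 * u <= tau ^ 2 * (9 * X)) by (apply Rmult_le_compat_l; lra).
      assert (tau ^ 2 * - (9 * X) <= tau ^ 2 * u) by (apply Rmult_le_compat_l; lra).
      assert (tau ^ 2 * (9 * X) <= t1 * (9 * X)) by (apply Rmult_le_compat_r; lra). lra. }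
    assert (X3 := X2 (8 * c - 6 * y) ltac:(lra)); assert (X4 := X2 (8 * y - 4 * c) ltac:(lra)).
    rewrite Rabs_mult, (Rabs_right (exp _)) by (apply Rle_ge, Rlt_le, exp_pos).
    apply Rmult_le_compat; [apply Rlt_le, exp_pos | apply Rabs_pos | exact X1 |].
    apply Rle_trans with (1 := Rabs_triang _ _); rewrite !Rabs_mult.
    apply Rplus_le_compat; apply Rmult_le_compat; try apply Rabs_pos; apply Rabs_le; unfold D1, D2; lra. }
  assert (Q' : Rabs (RInt f c X - qsum f l) <= 2 * (kE * (C2 / tau ^ 1)) + INR J * e).
  { eapply Rle_trans; [apply (L3 f (fun y => kE * (y ^ 0 * exp (- (tau * y) ^ 2 / 4))) Hf)|].
    - intro x; apply (continuous_scal_r kE (fun y => y ^ 0 * exp (- (tau * y) ^ 2 / 4))), DE.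
    - exact Hlip.
    - intros x Hx; destruct (contour_panel c p tau r x ltac:(lra) ltac:(lra)) as (P & P1 & P2).
      exists P; split; [exact P1 | exact P2].
    - apply Rplus_le_compat_r, Rmult_le_compat_l; [lra|].
      assert (ES : RInt (fun y => kE * (y ^ 0 * exp (- (tau * y) ^ 2 / 4))) c X
         = kE * RInt (fun y => y ^ 0 * exp (- (tau * y) ^ 2 / 4)) c X).
      { apply (RInt_scal (V := R_CompleteNormedModule) (fun y => y ^ 0 * exp (- (tau * y) ^ 2 / 4)) c X kE).
        apply ex_RInt_cont, DE. }
      apply Rle_trans with (1 := Req_le _ _ ES).
      apply Rmult_le_compat_l; [unfold kE; apply Rmult_le_pos; [lra | apply Rlt_le, exp_pos]|].
      apply Hmom; lra. }
  rewrite pow_1 in Q'.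
  rewrite (qsum_map _ (fun _ => / K) (fun y => y)).
  rewrite qsum_scal; fold f.
  set (Qf := qsum f l) in *.
  set (g := exp (- r ^ 2 / (4 * tau ^ 2))).
  assert (Hg : 0 < g <= 1).
  { split; [apply exp_pos|]; unfold g; rewrite <- exp_0; apply exp_le.
    assert (0 <= r ^ 2 / (4 * tau ^ 2)) by (apply Rdiv_le_0_compat; nra).
    unfold Rdiv in *; lra. }
  assert (HtX1 : sqrt ell <= tau * X) by nra.
  assert (V := contour_value c tau r X Hc HX4 ltac:(lra) ltac:(lra) ltac:(lra)).
  fold f g in V; set (b := 2 * tau * (X - c)) in *.
  assert (Hb : tau * X <= b).
  { unfold b; replace (2 * tau * (X - c)) with (tau * (2 * (X - c))) by ring; apply Rmult_le_compat_l; lra. }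
  assert (HbB : b <= B) by (unfold b, B; apply Rmult_le_compat_r; lra).
  assert (T0 := gauss_tail b B ltac:(lra)).
  assert (Eell : exp (- ell) = eta / A).
  { rewrite <- ElnA, exp_Ropp, exp_ln by (apply Rdiv_lt_0_compat; lra); field; split; lra. }
  assert (HV1 : exp (- (tau * X) ^ 2) <= eta / A).
  { rewrite <- Eell; apply exp_le; rewrite <- Hse2; nra. }
  assert (HV2 : exp (- b ^ 2) <= eta / A).
  { apply Rle_trans with (2 := HV1); apply exp_le; nra. }
  assert (HkE : kE <= 3 * (eta / A)).
  { unfold kE; rewrite <- Eell; apply Rmult_le_compat_l; [lra|]; apply exp_le.
    assert (c ^ 2 * tau ^ 2 <= c ^ 2 * t1) by (apply Rmult_le_compat_l; [apply pow2_ge_0 | lra]).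
    assert (c ^ 2 * t1 = ell) by (unfold t1; rewrite <- Hse2, <- EcT; ring). lra. }
  set (Ib := RInt (fun y => exp (- y ^ 2)) 0 b) in *.
  assert (SK : K = Ib + RInt (fun y => exp (- y ^ 2)) b B).
  { unfold K, Ib; symmetry; apply (RInt_Chasles (V := R_CompleteNormedModule)); apply ex_RInt_cont, continuous_gauss. }
  set (Itail := RInt (fun y => exp (- y ^ 2)) b B) in *.
  assert (R1 : Rabs (tau * (RInt f c X - Qf)) <= 6 * C2 * (eta / A) + eta / 12).
  { rewrite Rabs_mult, Rabs_right by lra.
    apply Rle_trans with (tau * (2 * (kE * (C2 / tau)) + INR J * e)); [apply Rmult_le_compat_l; lra|].
    rewrite Rmult_plus_distr_l; apply Rplus_le_compat.
    - replace (tau * (2 * (kE * (C2 / tau)))) with (2 * C2 * kE) by (field; lra).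
      apply Rle_trans with (2 * C2 * (3 * (eta / A))); [apply Rmult_le_compat_l; lra | lra].
    - apply Rle_trans with (sT * ((INR J + 1) * e)).
      + apply Rmult_le_compat; try lra; apply Rmult_le_pos; lra.
      + right; unfold e; field; split; lra. }
  assert (R2 : Rabs (tau * Qf - g * K) <= (2 + 6 * C2) * (eta / A) + eta / 12).
  { replace (tau * Qf - g * K) with ((tau * RInt f c X - g * Ib) + (- (g * Itail)) + (- (tau * (RInt f c X - Qf))))
      by (rewrite SK; ring).
    apply Rle_trans with (eta / A + eta / A + (6 * C2 * (eta / A) + eta / 12)); [|lra].
    apply Rabs_3.
    - lra.
    - rewrite Rabs_Ropp, Rabs_right by (apply Rle_ge, Rmult_le_pos; lra).
      apply Rle_trans with (1 * Itail); [apply Rmult_le_compat_r; lra | lra].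
    - rewrite Rabs_Ropp; exact R1. }
  replace (tau * (/ K * Qf) - g) with (/ K * (tau * Qf - g * K)) by (field; lra).
  rewrite Rabs_mult, Rabs_right by (apply Rle_ge, Rlt_le, Rinv_0_lt_compat; lra).
  apply Rmult_le_reg_l with K; [lra|].
  rewrite <- Rmult_assoc, Rinv_r, Rmult_1_l by lra.
  apply Rle_trans with (1 := R2).
  assert (EA : (2 + 6 * C2) * (eta / A) = eta / 6) by (unfold A; field; lra).
  rewrite EA; assert (/ 3 * eta <= K * eta) by (apply Rmult_le_compat_r; lra); lra.
Qed.

(** * Assembly of the kernel *)

Lemma dotn_pos d u : 0 <= dotn d u u.
Proof. induction d as [|d IH]; simpl; [lra | nra]. Qed.

Lemma dotn_Cauchy_Schwarz d u v : Rabs (dotn d u v) <= vnorm d u * vnorm d v.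
Proof.
assert (H : dotn d u v ^ 2 <= dotn d u u * dotn d v v).
{ induction d as [|d IH]; simpl dotn; [lra|].
  assert (HA := dotn_pos d u); assert (HB := dotn_pos d v).
  set (S := dotn d u v) in *; set (A := dotn d u u) in *; set (B := dotn d v v) in *.
  set (x := u d); set (y := v d).
  assert (H2 : 2 * S * x * y <= A * y ^ 2 + B * x ^ 2).
  { apply Rle_trans with (Rabs (2 * S * x * y)); [apply Rle_abs|].
    rewrite <- (Rabs_right (A * y ^ 2 + B * x ^ 2)) by nra.
    apply Rsqr_le_abs_0; unfold Rsqr.
    assert (0 <= (A * y ^ 2 - B * x ^ 2) ^ 2) by apply pow2_ge_0.
    assert (S ^ 2 * (x ^ 2 * y ^ 2) <= A * B * (x ^ 2 * y ^ 2)).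
    { apply Rmult_le_compat_r; [|exact IH]; apply Rmult_le_pos; apply pow2_ge_0. }
    nra. }
  nra. }
unfold vnorm; rewrite <- sqrt_mult by apply dotn_pos.
rewrite <- sqrt_Rsqr_abs; apply sqrt_le_1_alt; unfold Rsqr; lra.
Qed.

Lemma Cmul_Cexp a b : Cmul (Cexp a) (Cexp b) = Cexp (Cadd a b).
Proof.
unfold Cmul, Cexp, Cadd; cbn [fst snd]; rewrite exp_plus, cos_plus, sin_plus; f_equal; ring.
Qed.

(** The branch condition on the nodes: on the right half plane the principal root inverts squaring,
    so s = z^2 returns z. *)
Lemma Csqrt_sqr a b : 0 < a -> Csqrt (a ^ 2 - b ^ 2, 2 * a * b) = (a, b).
Proof.
intro Ha; unfold Csqrt.
assert (E : Cmod (a ^ 2 - b ^ 2, 2 * a * b) = a ^ 2 + b ^ 2).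
{ unfold Cmod; cbn [fst snd].
  replace ((a ^ 2 - b ^ 2) ^ 2 + (2 * a * b) ^ 2) with (Rsqr (a ^ 2 + b ^ 2)) by (unfold Rsqr; ring).
  apply sqrt_Rsqr; nra. }
rewrite E; cbn [fst snd]; f_equal.
- replace ((a ^ 2 + b ^ 2 + (a ^ 2 - b ^ 2)) / 2) with (Rsqr a) by (unfold Rsqr; field).
  apply sqrt_Rsqr; lra.
- replace ((a ^ 2 + b ^ 2 - (a ^ 2 - b ^ 2)) / 2) with (Rsqr b) by (unfold Rsqr; field).
  rewrite sqrt_Rsqr_abs.
  destruct (Rlt_dec (2 * a * b) 0) as [H|H].
  + rewrite Rabs_left by nra; ring.
  + rewrite Rabs_right by nra; ring.
Qed.

Lemma Csum_ext n f g : (forall i, (i < n)%nat -> f i = g i) -> Csum n f = Csum n g.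
Proof. induction n as [|n IH]; simpl; intro H; [reflexivity | rewrite IH, H; auto]. Qed.

Lemma Csum_head n f : Csum (S n) f = Cadd (f O) (Csum n (fun i => f (S i))).
Proof.
induction n as [|n IH].
- simpl; unfold Cadd, RtoC; destruct (f O); cbn; f_equal; ring.
- change (Csum (S (S n)) f) with (Cadd (Csum (S n) f) (f (S n))); rewrite IH; simpl.
  unfold Cadd; cbn [fst snd]; f_equal; ring.
Qed.

(** Groups k with -k, the indices of conjugate nodes. *)
Lemma Csum_symmetric N (h : Z -> Cx) :
  Csum (2 * N + 1) (fun i => h (Z.of_nat i - Z.of_nat N)%Z)
  = Cadd (h 0%Z) (Csum N (fun i => Cadd (h (Z.of_nat (S i))) (h (- Z.of_nat (S i))%Z))).
Proof.
induction N as [|N IH].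
- simpl; unfold Cadd, RtoC; destruct (h 0%Z); cbn; f_equal; ring.
- replace (2 * S N + 1)%nat with (S (S (2 * N + 1))) by lia.
  rewrite Csum_head.
  change (Csum (S ?n) ?f) with (Cadd (Csum n f) (f n)).
  rewrite (Csum_ext _ _ (fun i => h (Z.of_nat i - Z.of_nat N)%Z)) by (intros; f_equal; lia).
  rewrite IH; simpl Csum.
  replace (Z.of_nat 0 - Z.of_nat (S N))%Z with (- Z.of_nat (S N))%Z by lia.
  replace (Z.of_nat (S (2 * N + 1)) - Z.of_nat (S N))%Z with (Z.of_nat (S N)) by lia.
  unfold Cadd; cbn [fst snd]; f_equal; ring.
Qed.

Lemma Csum_factor n a z : Csum n (fun i => Cmul (a i) z) = Cmul (Csum n a) z.
Proof.
induction n as [|n IH]; simpl; [|rewrite IH]; unfold Cmul, Cadd, RtoC; cbn [fst snd]; f_equal; ring.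
Qed.

Lemma Csum_qsum g k l dflt : 
  Csum (length l) (fun i => RtoC (fst (nth i l dflt) * g (snd (nth i l dflt)) * k))
  = RtoC (qsum g l * k).
Proof.
induction l as [|p l IH]; [simpl; f_equal; ring|].
cbn [length]; rewrite Csum_head; cbn [nth qsum]; rewrite IH.
unfold Cadd, RtoC; cbn [fst snd]; f_equal; ring.
Qed.

(* The two conjugate nodes s = z^2, z = x +- 2i (x - c), carry the weights v (2 -+ i) / 2. *)
Lemma conjugate_pair c t r x v : 0 < c < x ->
  let term b wt := Cmul wt (Cmul (Cexp (Cmul (x ^ 2 - b ^ 2, 2 * x * b) (RtoC t)))
                    (Cexp (Cmul (RtoC (- r)) (Csqrt (x ^ 2 - b ^ 2, 2 * x * b))))) in
  Cadd (term (2 * (x - c)) (v, - v / 2)) (term (- (2 * (x - c))) (v, v / 2))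
  = RtoC (v * contour_integrand c t r x).
Proof.
intro Hx; cbv zeta beta; rewrite !Csqrt_sqr, !Cmul_Cexp by lra.
assert (E : forall b, (b = 2 * (x - c) \/ b = - (2 * (x - c))) ->
  Cadd (Cmul (x ^ 2 - b ^ 2, 2 * x * b) (RtoC t)) (Cmul (RtoC (- r)) (x, b))
  = (phase_re c t r x, b / (2 * (x - c)) * phase_im c t r x)).
{ intros b Hb; unfold Cadd, Cmul, RtoC, phase_re, phase_im; cbn [fst snd].
  destruct Hb as [-> | ->]; f_equal; field; lra. }
rewrite !E by auto.
replace (2 * (x - c) / (2 * (x - c))) with 1 by (field; lra).
replace (- (2 * (x - c)) / (2 * (x - c))) with (-1) by (field; lra).
unfold contour_integrand, Cadd, Cmul, Cexp, RtoC; cbn [fst snd].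
set (q := phase_im c t r x).
replace (1 * q) with q by ring; replace (-1 * q) with (- q) by ring.
rewrite cos_neg, sin_neg; f_equal; field.
Qed.

Lemma Rpower_half_nat x n : 0 < x -> Rpower x (INR n / 2) = sqrt x ^ n.
Proof.
intro Hx; rewrite <- Rpower_pow by now apply sqrt_lt_R0.
rewrite <- Rpower_sqrt, Rpower_mult by exact Hx; f_equal; field.
Qed.

Theorem theorem3 :
  forall d : nat, (1 <= d)%nat ->
  exists Cd : R, 0 < Cd /\
  forall (eps Rr T delta : R),
    0 < eps < 0.1 -> 1 < Rr -> 0 < delta -> 1000 * delta <= T ->
    exists N1 N2 : nat,
      (1 <= N1)%nat /\ (1 <= N2)%nat /\
      INR N1 <= Cd * ln (T / delta) * (ln (1 / eps) + ln (ln (T / delta)) + ln Rr) /\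
      INR N2 <= Cd * (ln (1 / eps) + ln Rr) * (ln (T / delta) + ln (1 / eps) + ln Rr) /\
      exists (wt lam : nat -> R) (w s : Z -> Cx),
        (forall j : nat, (1 <= j <= N2)%nat -> 0 < wt j /\ 0 < lam j) /\
        (forall k : Z, (- Z.of_nat N1 <= k <= Z.of_nat N1)%Z -> ~ on_neg_real_axis (s k)) /\
        forall (x y ny : nat -> R) (t : R),
          unit_vec d ny -> vnorm d (vsub x y) <= Rr -> delta <= t <= T ->
          Cmod (Csub (RtoC (Dker d x y ny t)) (DAker d N1 N2 wt lam w s x y ny t))
            < eps / Rpower t ((INR d + 2) / 2).
Proof.
intros d _.
destruct (power_exponential_sum d) as (CA & HCA & PA).
destruct gaussian_exponential_sum as (CB & HCB & PB).
(* The factors 4 and 2 come from ln (1/eta) <= 2 L, used twice in the bound for N2 and once in that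
   for N1; the 1 pays for the extra pair. *)
set (Cd := 4 * CA + 2 * CB + 1).
exists Cd; split; [unfold Cd; lra|].
intros eps Rr T delta Heps HR Hdelta HT.
(* The factor (x-y).n is at most R in size and the two approximations err by 3 eta together, so the
   total is at most 3 eps / 10. This is how log R enters the counts. *)
set (eta := eps / (10 * Rr)).
assert (Eeta : eta * (10 * Rr) = eps) by (unfold eta; field; lra).
assert (Heta : 0 < eta < 1 / 10).
{ split; [apply Rdiv_lt_0_compat; lra | nra]. }
assert (H10 : 10 < 1 / eps).
{ apply Rmult_lt_reg_r with eps; [lra|]; replace (1 / eps * eps) with 1 by (field; lra); lra. }
set (Lam := ln (T / delta)) in *.
assert (HLam : 1 <= Lam).
{ apply ln_ge_1; apply Rmult_lt_reg_r with delta; [lra|].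
  replace (T / delta * delta) with T by (field; lra); lra. }
assert (HlLam : 0 <= ln Lam).
{ rewrite <- ln_1; destruct HLam as [H|<-]; [left; apply ln_increasing; lra | lra]. }
assert (HlR : 0 < ln Rr) by (rewrite <- ln_1; apply ln_increasing; lra).
assert (Hle : 1 <= ln (1 / eps)) by now apply ln_ge_1.
set (L := ln (1 / eps) + ln Rr).
assert (Hleta : 0 < ln (1 / eta) <= 2 * L).
{ assert (Ee : 1 / eta = 10 * (1 / eps * Rr)) by (unfold eta; field; lra).
  assert (P1 : 0 < 1 / eps * Rr) by (apply Rmult_lt_0_compat; lra).
  rewrite Ee, ln_mult, ln_mult by lra.
  assert (0 < ln 10 <= ln (1 / eps)).
  { split; [rewrite <- ln_1|left]; apply ln_increasing; lra. }
  unfold L; lra. }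
destruct (PA eta delta T Heta Hdelta HT) as (la & A1 & A2 & A3).
destruct (PB eta delta T Rr Heta Hdelta HT ltac:(lra)) as (c & lb & Hc & B1 & B2 & B3).
fold Lam in A1, B1.
(* The constant of the kernel, later put into the contour weights. *)
pose (cd := / (2 * sqrt (4 * PI) ^ d)).
assert (HPI := PI_RGT_0).
assert (HP4 : 1 <= sqrt (4 * PI)).
{ rewrite <- sqrt_1; apply sqrt_le_1_alt; assert (H := PI2_1); lra. }
assert (HP4d : 1 <= sqrt (4 * PI) ^ d) by now apply pow_R1_Rle.
assert (Hcd : 0 < cd <= 1).
{ unfold cd; split; [apply Rinv_0_lt_compat; lra|].
  rewrite <- Rinv_1; apply Rinv_le_contravar; lra. }
exists (S (length lb)), (length la).
split; [lia|]; split; [|split; [|split]].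
(* An empty sum would have relative error 1 > eta. *)
- destruct la as [|]; [|simpl; lia].
  assert (H := A3 (sqrt delta) ltac:(split; [lra | apply sqrt_le_1_alt; lra])).
  simpl qsum in H; rewrite Rmult_0_r, Rminus_0_l, Rabs_Ropp, Rabs_R1 in H; lra.
- rewrite S_INR.
  apply Rle_trans with (Cd * Lam * L).
  + assert (CB * Lam * ln (1 / eta) <= CB * Lam * (2 * L)).
    { apply Rmult_le_compat_l; [apply Rmult_le_pos; lra | lra]. }
    assert (1 <= Lam * L) by (unfold L; nra).
    assert (0 <= 4 * CA * (Lam * L)) by (apply Rmult_le_pos; lra).
    unfold Cd; lra.
  + apply Rmult_le_compat_l; [apply Rmult_le_pos; unfold Cd; lra | unfold L; lra].
- apply Rle_trans with (1 := A1).
  rewrite Rplus_assoc; fold L.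
  assert (HL : 1 <= L) by (unfold L; lra).
  assert (H1 : CA * ln (1 / eta) * (Lam + ln (1 / eta)) <= CA * (2 * L) * (2 * (Lam + L))).
  { apply Rmult_le_compat; try lra; [apply Rmult_le_pos; lra | apply Rmult_le_compat_l; lra]. }
  assert (H2 : 0 <= (2 * CB + 1) * (L * (Lam + L))).
  { repeat apply Rmult_le_pos; lra. }
  unfold Cd; lra.
(* The term k = 0 and the outermost pair, which makes N1 positive, have weight 0. *)
- pose (nodeA := fun j => nth (pred j) la (1, 1)).
  (* The default serves the outermost pair: weight 0, and c + 1 > c so that its s also avoids the
     negative axis. [pred] makes the lists start at index 1. *)
  pose (nodeB := fun j => nth (pred j) lb (0, c + 1)).
  pose (sgn := fun k : Z => match k with Zneg _ => -1 | _ => 1 end).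
  pose (s := fun k : Z => match k with
     | Z0 => RtoC 1
     | _ => let x := snd (nodeB (Z.abs_nat k)) in
            let b := sgn k * (2 * (x - c)) in (x ^ 2 - b ^ 2, 2 * x * b)
     end).
  pose (w := fun k : Z => match k with
     | Z0 => RtoC 0
     | _ => let v := fst (nodeB (Z.abs_nat k)) * cd in (v, - sgn k * (v / 2))
     end).
  exists (fun j => fst (nodeA j)), (fun j => snd (nodeA j)), w, s.
  assert (HB : forall j, c < snd (nodeB j)).
  { intro j; unfold nodeB; destruct (nth_in_or_default (pred j) lb (0, c + 1)) as [H|H].
    - now apply B2.
    - rewrite H; cbn; lra. }
  split; [|split].
  + intros j Hj; apply A2, nth_In; lia.
  (* For k <> 0 the imaginary part of s is +- 4 x (x - c), nonzero because x > c > 0. *)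
  + intros k _ [H1 H2]; destruct k as [|k|k]; [cbn in H2; lra| |];
      unfold s, sgn in H1, H2; cbn [fst snd] in H1, H2;
      match type of H1 with context [snd (nodeB ?j)] => assert (Hx := HB j) end; nra.
  + intros x y ny t Hny Hxy Ht.
    set (r := vnorm d (vsub x y)) in *.
    set (dn := dotn d (vsub x y) ny).
    assert (Hr : 0 <= r) by apply sqrt_pos.
    assert (Hdn : Rabs dn <= Rr).
    { assert (H := dotn_Cauchy_Schwarz d (vsub x y) ny); rewrite Hny in H; fold r dn in H; lra. }
    set (tau := sqrt t).
    assert (Htau : 0 < tau) by (apply sqrt_lt_R0; lra).
    assert (Et : t = tau ^ 2) by (unfold tau; rewrite pow2_sqrt; lra).
    assert (Htau2 : sqrt delta <= tau <= sqrt T) by (split; apply sqrt_le_1_alt; lra).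
    set (SA := qsum (fun lam => exp (- lam * t)) la).
    set (SB := qsum (contour_integrand c t r) lb).
    assert (EDA : DAker d (S (length lb)) (length la) (fun j => fst (nodeA j)) (fun j => snd (nodeA j)) w s x y ny t
       = RtoC (SA * dn * (SB * cd))).
    { pose (term := fun k => Cmul (w k) (Cmul (Cexp (Cmul (s k) (RtoC t))) (Cexp (Cmul (RtoC (- r)) (Csqrt (s k)))))).
      assert (Epair : forall i, Cadd (term (Z.of_nat (S i))) (term (- Z.of_nat (S i))%Z)
         = RtoC (fst (nth i lb (0, c + 1)) * contour_integrand c t r (snd (nth i lb (0, c + 1))) * cd)).
      { intro i; unfold term; set (x0 := snd (nth i lb (0, c + 1))); set (v := fst (nth i lb (0, c + 1))).
        assert (Hx0 : c < x0) by apply (HB (S i)).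
        replace (v * contour_integrand c t r x0 * cd) with ((v * cd) * contour_integrand c t r x0) by ring.
        assert (CP := conjugate_pair c t r x0 (v * cd) ltac:(lra)); cbv zeta beta in CP; rewrite <- CP.
        assert (Ep : w (Z.of_nat (S i)) = (v * cd, - (v * cd) / 2)
           /\ s (Z.of_nat (S i)) = (x0 ^ 2 - (2 * (x0 - c)) ^ 2, 2 * x0 * (2 * (x0 - c)))).
        { assert (En : nodeB (Z.abs_nat (Z.of_nat (S i))) = nth i lb (0, c + 1)) by now rewrite Zabs2Nat.id.
          unfold w, s, sgn; change (Z.of_nat (S i)) with (Z.pos (Pos.of_succ_nat i)) in *; rewrite En; fold x0 v.
          split; f_equal; field. }
        assert (Em : w (- Z.of_nat (S i))%Z = (v * cd, v * cd / 2)
           /\ s (- Z.of_nat (S i))%Z = (x0 ^ 2 - (- (2 * (x0 - c))) ^ 2, 2 * x0 * (- (2 * (x0 - c))))).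
        { assert (En : nodeB (Z.abs_nat (- Z.of_nat (S i))) = nth i lb (0, c + 1)) by now replace (Z.abs_nat (- Z.of_nat (S i))) with (S i) by lia.
          unfold w, s, sgn; change (- Z.of_nat (S i))%Z with (Z.neg (Pos.of_succ_nat i)) in *; rewrite En; fold x0 v.
          split; f_equal; field. }
        destruct Ep as [-> ->], Em as [-> ->]; reflexivity. }
      assert (Ei : Csum (2 * S (length lb) + 1) (fun i => term (Z.of_nat i - Z.of_nat (S (length lb)))%Z) = RtoC (SB * cd)).
      { rewrite Csum_symmetric, (Csum_ext _ _ _ (fun i _ => Epair i)).
        change (Csum (S ?n) ?f) with (Cadd (Csum n f) (f n)).
        rewrite (Csum_qsum (contour_integrand c t r) cd); fold SB; cbv beta.
        rewrite (nth_overflow lb) by lia.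
        unfold term, w, Cadd, Cmul, RtoC; cbn [fst snd]; f_equal; ring. }
      unfold DAker; cbv zeta; fold r dn.
      change (Csum (2 * S (length lb) + 1) _) with
        (Csum (2 * S (length lb) + 1) (fun i => term (Z.of_nat i - Z.of_nat (S (length lb)))%Z)).
      rewrite Ei.
      rewrite (Csum_ext _ _ (fun i => Cmul (RtoC (fst (nth i la (1, 1)) * (exp (- snd (nth i la (1, 1)) * t)) * dn)) (RtoC (SB * cd))))
        by reflexivity.
      rewrite Csum_factor, (Csum_qsum (fun lam => exp (- lam * t)) dn); fold SA.
      unfold Cmul, RtoC; cbn [fst snd]; f_equal; ring. }
    rewrite EDA.
    assert (EP : Rpower t ((INR d + 2) / 2) = tau ^ S (S d)).
    { replace (INR d + 2) with (INR (S (S d))) by (rewrite !S_INR; ring).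
      apply Rpower_half_nat; lra. }
    set (g := exp (- r ^ 2 / (4 * t))).
    assert (Htp : 0 < tau ^ S (S d)) by now apply pow_lt.
    assert (Htd : 0 < tau ^ d) by now apply pow_lt.
    assert (ED : Dker d x y ny t = dn * cd * g / tau ^ S (S d)).
    { unfold Dker; fold r dn g; rewrite Rpower_half_nat by (apply Rmult_lt_0_compat; lra).
      rewrite sqrt_mult by lra; fold tau; rewrite Rpow_mult_distr, Et; unfold cd; simpl.
      field; repeat split; lra. }
    (* The powers of t split as tau^{d+2} = tau^{d+1} tau, so a is close to 1 and b to the Gaussian;
       their product errs by |b - g| + |b| |a - 1|. *)
    set (a := tau ^ S d * SA); set (b := tau * SB).
    assert (HA := A3 tau Htau2); rewrite <- Et in HA; fold SA a in HA.
    assert (HBb := B3 tau r Htau2 ltac:(lra)); rewrite <- Et in HBb; fold SB b g in HBb.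
    assert (Hg : 0 < g <= 1).
    { split; [apply exp_pos|]; unfold g; rewrite <- exp_0; apply exp_le.
      assert (0 <= r ^ 2 / (4 * t)) by (apply Rdiv_le_0_compat; nra).
      unfold Rdiv in *; lra. }
    assert (Hgab : Rabs (g - a * b) <= 3 * eta).
    { replace (g - a * b) with (- (b - g) + - (b * (a - 1))) by ring.
      apply Rle_trans with (1 := Rabs_triang _ _); rewrite !Rabs_Ropp, Rabs_mult.
      assert (Hb : Rabs b <= 2).
      { replace b with ((b - g) + g) by ring; apply Rle_trans with (1 := Rabs_triang _ _).
        rewrite (Rabs_right g) by lra; lra. }
      assert (Rabs b * Rabs (a - 1) <= 2 * eta) by (apply Rmult_le_compat; try apply Rabs_pos; lra).
      lra. }
    replace (Csub (RtoC (Dker d x y ny t)) (RtoC (SA * dn * (SB * cd))))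
      with (RtoC (dn * cd * (g - a * b) / tau ^ S (S d))).
    2:{ rewrite ED; unfold Csub, RtoC, a, b; cbn [fst snd]; f_equal; [simpl; field; lra | ring]. }
    apply Rle_lt_trans with (1 := Cmod_le_sum _); cbn [fst snd RtoC]; rewrite Rabs_R0, Rplus_0_r, EP.
    unfold Rdiv; rewrite Rabs_mult, (Rabs_right (/ _)) by (apply Rle_ge, Rlt_le, Rinv_0_lt_compat; lra).
    apply Rmult_lt_compat_r; [now apply Rinv_0_lt_compat|].
    rewrite !Rabs_mult, (Rabs_right cd) by lra.
    apply Rle_lt_trans with (Rr * 1 * (3 * eta)); [|lra].
    apply Rmult_le_compat; [apply Rmult_le_pos; [apply Rabs_pos | lra] | apply Rabs_pos | | exact Hgab].
    apply Rmult_le_compat; try apply Rabs_pos; lra.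
Qed.
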